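(* The following series representations hold: $$\zeta(3)=-\frac{\pi^2}{13}\ln3-\frac{4\pi^2}{13}\sum_{k=0}^\infty\frac{2k+3}{(2k+1)(2k+2)}\frac{\zeta(2k)}{3^{2k}},$$ $$\zeta(3)=-\frac{2\pi^2}{35}\ln2-\frac{8\pi^2}{35}\sum_{k=0}^\infty\frac{2k+3}{(2k+1)(2k+2)}\frac{\zeta(2k)}{4^{2k}},$$ $$\zeta(3)=-\frac{\pi^2}{6}\sum_{k=0}^\infty\frac{2k+3}{(2k+1)(2k+2)}\frac{\zeta(2k)}{6^{2k}}.$$
   Context: $\zeta$ is the Riemann zeta function (analytically continued), so $\zeta(0)=-1/2$. *)

(* Defs.v *)
From Stdlib Require Export Reals.
From Coquelicot Require Export Coquelicot.

Open Scope R_scope.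

Definition Cexp (z : C) : C :=
  (exp (Re z) * cos (Im z), exp (Re z) * sin (Im z)).

(* Meant for n >= 1: Stdlib's [ln] takes a junk value at 0. *)
Definition nat_Cpow (n : nat) (s : C) : C :=
  Cexp (Cmult s (RtoC (ln (INR n)))).

Definition analytic_at (f : C -> C) (s0 : C) : Prop :=
  exists a : nat -> C,
    locally (T := C_UniformSpace) s0
      (fun s => is_pseries (K := C_AbsRing) (V := C_NormedModule)
                  a (Cminus s s0) (f s)).

(* [zeta] is the analytic continuation to C \ {1} of the Dirichlet series
   sum_{n >= 1} n^{-s}, Re s > 1.  By the identity theorem this determines
   [zeta] on C \ {1}; its value at the pole 1 is left arbitrary. *)
Definition is_riemann_zeta (zeta : C -> C) : Prop :=
  (forall s : C, 1 < Re s ->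
     is_series (K := C_AbsRing) (V := C_NormedModule)
       (fun n : nat => nat_Cpow (S n) (Copp s)) (zeta s)) /\
  (forall s : C, s <> RtoC 1 -> analytic_at zeta s).

Definition zeta_even_term (zeta : C -> C) (q : R) (k : nat) : C :=
  Cmult
    (RtoC (INR (2 * k + 3) / (INR (2 * k + 1) * INR (2 * k + 2))))
    (Cdiv (zeta (RtoC (INR (2 * k)))) (RtoC (q ^ (2 * k)))).

Definition is_zeta_even_sum (zeta : C -> C) (q : R) (S : C) : Prop :=
  is_series (K := C_AbsRing) (V := C_NormedModule) (zeta_even_term zeta q) S.

(* Main.v *)
Require Import Defs.
From Stdlib Require Import Reals Lra Lia Factorial.
From Coquelicot Require Import Coquelicot.

Open Scope R_scope.

(** Put L(x) = ln (2 sin (pi x)) and C(x) = sum_n cos (2 pi n x) / n^3. Since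
    c_k = (2k+3)/((2k+1)(2k+2)) = 1/(2k) - 1/(k(2k+1)(2k+2)) for k >= 1, the expansion
    ln (pi x / sin (pi x)) = sum_k zeta(2k) x^(2k) / k (Euler's sine product) and its second
    primitive give  sum_k c_k zeta(2k) x^(2k) = - L(x)/2 + K(x)/x^2  with K'' = L, while the
    Fourier series L(x) = - sum_n cos (2 pi n x)/n gives K = (C - zeta(3)) / (4 pi^2).
    At x = 1/3, 1/4, 1/6 the value C(x) is a rational multiple of zeta(3).

    The value zeta(0) = -1/2 comes from
      s (s+1) (1-s) B(s) = (1-s) (2 zeta(s) - 1) + 2,
      B(s) = sum_n int_n^(n+1) (v-n) (n+1-v) v^(-s-2) dv,
    obtained for Re s > 1 by integrating by parts twice. On every horizontal line Im s = y <> 0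
    both sides are real-analytic for Re s > -1, so the identity reaches s = i y; let y -> 0. *)


(* Equations produced by Coquelicot lemmas live in a structure over [R], which [ring] rejects. *)
Ltac eq_R := match goal with |- ?l = ?r => change (l = r :> R) end.

(** The term k = 0 is the obstacle: for k >= 1 the values zeta(2k) are Dirichlet series, whereas
    [is_riemann_zeta] reaches 0 only through local expansions. The real axis is blocked by the pole,
    where [zeta] is arbitrary; hence the detour over lines Im s = y <> 0, on which an identity
    theorem in one real variable suffices. The weight in B(s) comes from the trapezoidal rule. The
    factor s makes the left side vanish at s = 0, so that B is only bounded, never evaluated.

    The Fourier series of L converges only conditionally, and its error bound degenerates at x = 0,
    so it is not integrated from there. Integrating twice from x = 1/2, where the sine sums vanish,
    identifies K up to an affine function, which is zero because K(x) = o(x) and C(x) - zeta(3) =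
    O(x^(3/2)).

    For q = 3, 4, 6, cos (2 pi n / q) is a rational combination of indicators of divisibility of n,
    and the sum of n^(-3) over the multiples of d is zeta(3) / d^3. The logarithms come from 2 sin
    (pi / q) = sqrt 3, sqrt 2, 1, which is why the third formula has none. *)

Lemma continuous_of_ex_derive (f : R -> R) (x : R) : ex_derive f x -> continuous f x.
Proof. apply (ex_derive_continuous (K := R_AbsRing) (V := R_NormedModule)). Qed.

Lemma RInt_FTC (f df : R -> R) (a b : R) :
  (forall x, Rmin a b <= x <= Rmax a b -> is_derive f x (df x)) ->
  (forall x, Rmin a b <= x <= Rmax a b -> continuous df x) ->
  RInt df a b = f b - f a.
Proof.
  intros H1 H2. apply is_RInt_unique. apply (is_RInt_derive f df); assumption.
Qed.

Lemma sum_n_S (a : nat -> R) (n : nat) : sum_n a (S n) = sum_n a n + a (S n).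
Proof. exact (sum_Sn a n). Qed.

Lemma sum_n_mul_R (c : R) (a : nat -> R) (n : nat) : c * sum_n a n = sum_n (fun k => c * a k) n.
Proof. symmetry. exact (sum_n_mult_l (K := R_Ring) c a n). Qed.

Lemma is_series_mul_R (c : R) (a : nat -> R) (l : R) :
  is_series a l -> is_series (fun n => c * a n) (c * l).
Proof. exact (is_series_scal (K := R_AbsRing) (V := R_NormedModule) c a l). Qed.

Lemma is_series_plus_R (a b : nat -> R) (la lb : R) :
  is_series a la -> is_series b lb -> is_series (fun n => a n + b n) (la + lb).
Proof. exact (is_series_plus (K := R_AbsRing) (V := R_NormedModule) a b la lb). Qed.

Lemma is_series_minus_R (a b : nat -> R) (la lb : R) :
  is_series a la -> is_series b lb -> is_series (fun n => a n - b n) (la - lb).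
Proof. exact (is_series_minus (K := R_AbsRing) (V := R_NormedModule) a b la lb). Qed.

Lemma is_series_ext_R (a b : nat -> R) (l l' : R) :
  (forall n, a n = b n) -> l = l' -> is_series a l -> is_series b l'.
Proof. intros E <-. exact (is_series_ext (K := R_AbsRing) (V := R_NormedModule) a b l E). Qed.

Lemma is_series_tail_R (a : nat -> R) (l : R) :
  is_series a l -> is_series (fun n => a (S n)) (l - a 0%nat).
Proof.
  intros H. apply (is_series_incr_1 (K := R_AbsRing) (V := R_NormedModule)).
  change (is_series a (l - a 0%nat + a 0%nat)). now replace (l - a 0%nat + a 0%nat) with l by ring.
Qed.

Lemma is_RInt_sub (f g : R -> R) (a b If Ig : R) :
  is_RInt f a b If -> is_RInt g a b Ig -> is_RInt (fun t => f t - g t) a b (If - Ig).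
Proof. exact (is_RInt_minus (V := R_NormedModule) f g a b If Ig). Qed.

Lemma is_RInt_mul (f : R -> R) (k a b If : R) :
  is_RInt f a b If -> is_RInt (fun t => k * f t) a b (k * If).
Proof. exact (is_RInt_scal (V := R_NormedModule) f a b k If). Qed.

Lemma RInt_of_ex (f : R -> R) (a b : R) : ex_RInt f a b -> is_RInt f a b (RInt f a b).
Proof. exact (RInt_correct (V := R_CompleteNormedModule) f a b). Qed.

(** * Euler's sine product from cosine integrals *)

(** As [m] runs through the even numbers, the ratio [cos_integral x m / cos_integral 0 m] starts at
    sin (pi x) / (pi x), is divided by one factor 1 - x^2 / n^2 at each step, and tends to 1. This
    is the sine product. *)
Definition cos_integral (x : R) (m : nat) : R :=
  RInt (fun t => cos (2 * x * t) * cos t ^ m) 0 (PI / 2).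

Lemma cos_integrand_continuous (x : R) (m : nat) (t : R) :
  continuous (fun t => cos (2 * x * t) * cos t ^ m) t.
Proof. apply continuous_of_ex_derive. auto_derive. exact I. Qed.

Lemma cos_integrable (x : R) (m : nat) :
  ex_RInt (fun t => cos (2 * x * t) * cos t ^ m) 0 (PI / 2).
Proof.
  apply (ex_RInt_continuous (V := R_CompleteNormedModule)).
  intros; apply cos_integrand_continuous.
Qed.

Lemma cos_integral_rec (x : R) (m : nat) :
  ((INR m + 2) ^ 2 - 4 * x ^ 2) * cos_integral x (S (S m)) =
  (INR m + 2) * (INR m + 1) * cos_integral x m.
Proof.
  unfold cos_integral.
  (* [W] is a primitive of the difference of the two integrands. It vanishes at both ends, since
     each of its terms carries a sine that is 0 at 0 and a positive power of [cos t]. *)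
  set (W := fun t => (INR m + 2) * cos (2 * x * t) * cos t ^ (S m) * sin t
                     - 2 * x * sin (2 * x * t) * cos t ^ (S (S m))).
  set (g := fun t => ((INR m + 2) ^ 2 - 4 * x ^ 2) * (cos (2 * x * t) * cos t ^ (S (S m)))
         - (INR m + 2) * (INR m + 1) * (cos (2 * x * t) * cos t ^ m)).
  assert (H : RInt g 0 (PI / 2) = W (PI / 2) - W 0).
  { apply RInt_FTC.
    - intros t _. unfold W, g. auto_derive. exact I.
      replace (S m + 1)%nat with (S (S m)) by lia.
      cbn [Nat.pred pow].
      change (match m with 0%nat => 1 | S _ => INR m + 1 end) with (INR (S m)).
      rewrite S_INR.
      pose proof (sin2_cos2 t) as E. unfold Rsqr in E.
      assert (E2 : sin t * sin t = 1 - cos t * cos t) by lra.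
      match goal with |- ?l = ?r => 
        replace l with ((INR m + 2) * cos (2*x*t) * (cos t ^ m * cos t * cos t)
           - (INR m + 2) * (INR m + 1) * cos (2*x*t) * cos t ^ m * (sin t * sin t)
           - 4 * x * x * cos (2*x*t) * (cos t ^ m * cos t * cos t)) by ring end.
      rewrite E2. ring.
    - intros t _. unfold g. apply continuous_of_ex_derive. auto_derive. repeat split; auto. }
  assert (HW : W (PI / 2) - W 0 = 0).
  { unfold W. rewrite cos_PI2, sin_0. replace (2 * x * 0) with 0 by ring. rewrite sin_0.
    simpl. ring. }
  rewrite HW in H.
  assert (H2 : RInt g 0 (PI / 2) =
     ((INR m + 2) ^ 2 - 4 * x ^ 2) * RInt (fun t => cos (2 * x * t) * cos t ^ (S (S m))) 0 (PI / 2)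
     - (INR m + 2) * (INR m + 1) * RInt (fun t => cos (2 * x * t) * cos t ^ m) 0 (PI / 2)).
  { unfold g. apply is_RInt_unique.
    apply is_RInt_sub; apply is_RInt_mul; apply RInt_of_ex; apply cos_integrable. }
  rewrite H in H2. apply Rminus_diag_uniq. symmetry. exact H2.
Qed.

Lemma PI2_interval (t : R) : 0 <= t <= PI / 2 -> 0 <= cos t /\ 0 <= sin t.
Proof.
  intros Ht. pose proof PI_RGT_0. split.
  - apply cos_ge_0; lra.
  - apply sin_ge_0; lra.
Qed.

Lemma nonneg_derive_le (f df : R -> R) (a b : R) :
  a <= b -> (forall x, a <= x <= b -> is_derive f x (df x)) ->
  (forall x, a <= x <= b -> 0 <= df x) -> f a <= f b.
Proof.
  intros Hab Hd Hp.
  destruct (MVT_gen f a b df) as [c [Hc E]].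
  - rewrite Rmin_left, Rmax_right by lra. intros x Hx. apply Hd; lra.
  - rewrite Rmin_left, Rmax_right by lra. intros x Hx.
    apply continuity_pt_filterlim. apply continuous_of_ex_derive. eexists; apply Hd; lra.
  - rewrite Rmin_left, Rmax_right in Hc by lra.
    specialize (Hp c Hc). nra.
Qed.

(** This is t <= tan t with the cosine cleared, so that it also holds at [PI / 2]. It bounds t^2
    cos^2 t by 1 - cos^2 t, which turns a quadratic error into a difference of powers of the
    cosine. *)
Lemma mul_cos_le_sin (t : R) : 0 <= t <= PI / 2 -> t * cos t <= sin t.
Proof.
  intros Ht.
  enough (sin 0 - 0 * cos 0 <= sin t - t * cos t) by (rewrite sin_0 in *; lra).
  apply (nonneg_derive_le (fun t => sin t - t * cos t) (fun t => t * sin t)).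
  - lra.
  - intros x Hx. auto_derive. exact I. ring.
  - intros x Hx. apply Rmult_le_pos. lra. apply PI2_interval; lra.
Qed.

Lemma one_minus_cos_bounds (a : R) : 0 <= 1 - cos a <= a ^ 2 / 2.
Proof.
  replace a with (2 * (a / 2)) by field. rewrite cos_2a_sin.
  set (b := a / 2).
  assert (Rabs (sin b) <= Rabs b).
  { destruct (Rle_dec 0 b) as [h|h].
    - destruct (Req_dec b 0) as [->|h0]. rewrite sin_0; lra.
      rewrite (Rabs_pos_eq b) by lra.
      destruct (Rle_dec b 1) as [h1|h1].
      + pose proof PI2_1. rewrite Rabs_pos_eq.
        apply Rlt_le, sin_lt_x; lra. apply sin_ge_0; lra.
      + pose proof (SIN_bound b). apply Rabs_le. lra.
    - rewrite <- (Rabs_Ropp (sin b)), <- sin_neg, <- (Rabs_Ropp b).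
      rewrite (Rabs_pos_eq (- b)) by lra.
      destruct (Rle_dec (-b) 1) as [h1|h1].
      + pose proof PI2_1. rewrite Rabs_pos_eq.
        apply Rlt_le, sin_lt_x; lra. apply sin_ge_0; lra.
      + pose proof (SIN_bound (-b)). apply Rabs_le. lra. }
  apply Rsqr_le_abs_1 in H. unfold Rsqr in H. split; nra.
Qed.

Lemma cos_integral_pos (m : nat) : 0 < cos_integral 0 m.
Proof.
  unfold cos_integral. pose proof PI_RGT_0. apply RInt_gt_0.
  - lra.
  - intros t Ht. replace (2 * 0 * t) with 0 by ring. rewrite cos_0, Rmult_1_l.
    apply pow_lt. apply cos_gt_0; lra.
  - intros; apply cos_integrand_continuous.
Qed.

(** From 1 - cos (2xt) <= 2 x^2 t^2 and t cos t <= sin t, the defect of the integrand is at most 2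
    x^2 (cos^m t - cos^(m+2) t). The integral of this majorant is known exactly from the recurrence
    at x = 0 and supplies the decay 1/(m+1). *)
Lemma cos_integral_ratio_bound (x : R) (m : nat) :
  Rabs (1 - cos_integral x (S (S m)) / cos_integral 0 (S (S m))) <= 2 * x ^ 2 / (INR m + 1).
Proof.
  pose proof (cos_integral_pos (S (S m))) as Hp. pose proof (pos_INR m) as Hm.
  pose proof PI_RGT_0 as HPI.
  assert (E0 : (INR m + 2) * cos_integral 0 (S (S m)) = (INR m + 1) * cos_integral 0 m).
  { pose proof (cos_integral_rec 0 m). apply (Rmult_eq_reg_l (INR m + 2)); lra. }
  assert (HD : is_RInt (fun t => cos (2 * 0 * t) * cos t ^ (S (S m)) - cos (2 * x * t) * cos t ^ (S (S m)))
      0 (PI / 2) (cos_integral 0 (S (S m)) - cos_integral x (S (S m)))).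
  { apply is_RInt_sub; apply RInt_of_ex; apply cos_integrable. }
  assert (HU : is_RInt (fun t => (2 * x ^ 2) * (cos (2 * 0 * t) * cos t ^ m - cos (2 * 0 * t) * cos t ^ (S (S m))))
      0 (PI / 2) ((2 * x ^ 2) * (cos_integral 0 m - cos_integral 0 (S (S m))))).
  { apply is_RInt_mul. apply is_RInt_sub; apply RInt_of_ex; apply cos_integrable. }
  assert (Hb : forall t, 0 < t < PI / 2 ->
     0 <= cos (2 * 0 * t) * cos t ^ (S (S m)) - cos (2 * x * t) * cos t ^ (S (S m)) <=
       (2 * x ^ 2) * (cos (2 * 0 * t) * cos t ^ m - cos (2 * 0 * t) * cos t ^ (S (S m)))).
  { intros t Ht. replace (2 * 0 * t) with 0 by ring. rewrite cos_0.
    destruct (PI2_interval t) as [Hc Hs]; [lra|].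
    pose proof (mul_cos_le_sin t ltac:(lra)) as Hts.
    pose proof (one_minus_cos_bounds (2 * x * t)) as Hcb.
    pose proof (sin2_cos2 t) as E. unfold Rsqr in E.
    assert (Hcm : 0 <= cos t ^ m) by (apply pow_le; lra).
    assert (Hts2 : (t * cos t) * (t * cos t) <= sin t * sin t).
    { apply Rmult_le_compat; try lra; apply Rmult_le_pos; lra. }
    simpl pow.
    assert (Hcc : 0 <= cos t * (cos t * cos t ^ m)).
    { apply Rmult_le_pos; [lra|]. apply Rmult_le_pos; lra. }
    split.
    - nra.
    - apply Rle_trans with ((2 * x * t) ^ 2 / 2 * (cos t * (cos t * cos t ^ m))).
      + nra.
      + replace ((2 * x * t) ^ 2 / 2 * (cos t * (cos t * cos t ^ m)))
          with (2 * x ^ 2 * cos t ^ m * ((t * cos t) * (t * cos t))) by field.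
        replace (2 * (x * (x * 1)) * (1 * cos t ^ m - 1 * (cos t * (cos t * cos t ^ m))))
          with (2 * x ^ 2 * cos t ^ m * (1 - cos t * cos t)) by ring.
        apply Rmult_le_compat_l. apply Rmult_le_pos; nra. lra. }
  assert (L0 : 0 <= cos_integral 0 (S (S m)) - cos_integral x (S (S m))).
  { rewrite <- (is_RInt_unique _ _ _ _ HD). apply RInt_ge_0. lra. eexists; exact HD.
    intros t Ht; apply Hb; lra. }
  assert (L1 : cos_integral 0 (S (S m)) - cos_integral x (S (S m)) <=
      (2 * x ^ 2) * (cos_integral 0 m - cos_integral 0 (S (S m)))).
  { rewrite <- (is_RInt_unique _ _ _ _ HD), <- (is_RInt_unique _ _ _ _ HU).
    apply RInt_le. lra. eexists; exact HD. eexists; exact HU. intros t Ht; apply Hb; lra. }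
  assert (E1 : cos_integral 0 m - cos_integral 0 (S (S m)) = cos_integral 0 (S (S m)) / (INR m + 1)).
  { apply (Rmult_eq_reg_l (INR m + 1)); [|lra]. field_simplify; lra. }
  rewrite E1 in L1.
  replace (1 - cos_integral x (S (S m)) / cos_integral 0 (S (S m))) with
    ((cos_integral 0 (S (S m)) - cos_integral x (S (S m))) / cos_integral 0 (S (S m))) by (field; lra).
  rewrite Rabs_pos_eq by (apply Rdiv_le_0_compat; lra).
  apply Rle_div_l. lra.
  replace (2 * x ^ 2 / (INR m + 1) * cos_integral 0 (S (S m))) with
    (2 * x ^ 2 * (cos_integral 0 (S (S m)) / (INR m + 1))) by (field; lra). exact L1.
Qed.

(** Each factor of the product is a ratio of consecutive values of [r], so the partial sums
    telescope to the limit plus [ln (r (S N))], and [r] tends to 1. *)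
Lemma log_sine_product (x : R) : 0 < x < 1 ->
  is_series (fun n => - ln (1 - x ^ 2 / INR (S n) ^ 2)) (ln (PI * x / sin (PI * x))).
Proof.
  intros Hx. pose proof PI_RGT_0 as HPI.
  assert (Hsin : 0 < sin (PI * x)) by (apply sin_gt_0; nra).
  set (r := fun N => cos_integral x (2 * N) / cos_integral 0 (2 * N)).
  assert (Hfac : forall n, 0 < 1 - x ^ 2 / INR (S n) ^ 2).
  { intros n. assert (1 <= INR (S n)) by (rewrite S_INR; pose proof (pos_INR n); lra).
    assert (x ^ 2 / INR (S n) ^ 2 < 1); [|lra].
    apply Rlt_div_l. nra. nra. }
  assert (Hr0 : r 0%nat = sin (PI * x) / (PI * x)).
  { unfold r, cos_integral. simpl Nat.mul.
    rewrite (RInt_FTC (fun t => sin (2 * x * t) / (2 * x))), (RInt_FTC (fun t => t)).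
    - rewrite Rmult_0_r, sin_0. replace (2 * x * (PI / 2)) with (PI * x) by field. field. lra.
    - intros t _. auto_derive. exact I. replace (2 * 0 * t) with 0 by ring. rewrite cos_0. simpl; ring.
    - intros; apply cos_integrand_continuous.
    - intros t _. auto_derive. lra. simpl; field; lra.
    - intros; apply cos_integrand_continuous. }
  assert (Hrec : forall N, r N = (1 - x ^ 2 / INR (S N) ^ 2) * r (S N)).
  { intros N. unfold r. replace (2 * S N)%nat with (S (S (2 * N))) by lia.
    pose proof (cos_integral_rec x (2 * N)) as H1. pose proof (cos_integral_rec 0 (2 * N)) as H2.
    pose proof (cos_integral_pos (2 * N)). pose proof (cos_integral_pos (S (S (2 * N)))).
    assert (HN : INR (2 * N) + 2 = 2 * INR (S N)) by (rewrite mult_INR, (S_INR N); simpl; ring).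
    rewrite HN in H1, H2. pose proof (lt_0_INR (S N) ltac:(lia)). pose proof (pos_INR (2 * N)).
    set (n := INR (S N)) in *. set (q := INR (2 * N) + 1) in *. assert (0 < q) by (unfold q; lra).
    assert (A1 : cos_integral x (2 * N) = ((2 * n) ^ 2 - 4 * x ^ 2) * cos_integral x (S (S (2 * N))) / (2 * n * q))
      by (apply (Rmult_eq_reg_l (2 * n * q)); [rewrite <- H1; field; lra| nra]).
    assert (A2 : cos_integral 0 (2 * N) = (2 * n) ^ 2 * cos_integral 0 (S (S (2 * N))) / (2 * n * q)).
    { apply (Rmult_eq_reg_l (2 * n * q)); [rewrite <- H2; field; lra| nra]. }
    rewrite A1, A2. field. lra. }
  assert (Hrpos : forall N, 0 < r N).
  { induction N. rewrite Hr0. apply Rdiv_lt_0_compat; [lra|apply Rmult_lt_0_compat; lra].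
    specialize (Hrec N). specialize (Hfac N). nra. }
  assert (Hsum : forall N, sum_n (fun n => - ln (1 - x ^ 2 / INR (S n) ^ 2)) N
     = ln (PI * x / sin (PI * x)) + ln (r (S N))).
  { assert (Hl : ln (PI * x / sin (PI * x)) + ln (r 0%nat) = 0).
    { rewrite Hr0, <- ln_mult, <- ln_1; try (apply Rdiv_lt_0_compat; try apply Rmult_lt_0_compat; lra). f_equal. field. nra. }
    assert (Hst : forall N, ln (r N) = ln (1 - x ^ 2 / INR (S N) ^ 2) + ln (r (S N))).
    { intros N. rewrite (Hrec N) at 1. apply ln_mult; auto. }
    induction N.
    - rewrite sum_O. specialize (Hst 0%nat). lra.
    - rewrite sum_n_S, IHN. specialize (Hst (S N)). lra. }
  assert (Hlim : is_lim_seq (fun N => r (S N)) 1).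
  { apply is_lim_seq_ext with (fun N => 1 - (1 - r (S N))); [intros; ring|].
    replace (Finite 1) with (Finite (1 - 0)) by (f_equal; ring).
    apply is_lim_seq_minus'. apply is_lim_seq_const.
    apply is_lim_seq_abs_0.
    apply is_lim_seq_le_le with (fun _ => 0) (fun N => 2 * x ^ 2 * / (INR (2 * N) + 1)).
    - intros N. split. apply Rabs_pos. unfold r. replace (2 * S N)%nat with (S (S (2 * N))) by lia.
      apply cos_integral_ratio_bound.
    - apply is_lim_seq_const.
    - replace (Finite 0) with (Rbar_mult (2 * x ^ 2) 0) by (simpl; f_equal; ring).
      apply is_lim_seq_scal_l.
      apply is_lim_seq_ext with (fun N => / (INR (S (2 * N)))). intros; rewrite S_INR; reflexivity.
      replace (Finite 0) with (Rbar_inv p_infty) by reflexivity.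
      apply is_lim_seq_inv; [|discriminate].
      apply is_lim_seq_le_p_loc with INR. exists 0%nat; intros; apply le_INR; lia. apply is_lim_seq_INR. }
  change (is_lim_seq (sum_n (fun n => - ln (1 - x ^ 2 / INR (S n) ^ 2))) (ln (PI * x / sin (PI * x)))).
  apply is_lim_seq_ext with (fun N => ln (PI * x / sin (PI * x)) + ln (r (S N))).
  { intros; symmetry; apply Hsum. }
  replace (Finite (ln (PI * x / sin (PI * x)))) with (Finite (ln (PI * x / sin (PI * x)) + ln 1))
    by (rewrite ln_1; f_equal; ring).
  apply is_lim_seq_plus'. apply is_lim_seq_const.
  apply (is_lim_seq_continuous ln). 2: exact Hlim.
  apply continuity_pt_filterlim. apply continuous_of_ex_derive. auto_derive. lra.
Qed.

(** * Real-analytic functions and lines in the complex plane *)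


Lemma is_lim_seq_of_is_series (a : nat -> R) (l : R) : is_series a l <-> is_lim_seq (sum_n a) l.
Proof. split; intros H; exact H. Qed.

Lemma sum_n_fst (a : nat -> C) (n : nat) :
  fst (sum_n (G := C_AbelianMonoid) a n) = sum_n (fun k => fst (a k)) n.
Proof.
  induction n as [|n IH].
  - now rewrite !sum_O.
  - rewrite sum_n_S, <- IH, (sum_Sn (G := C_AbelianMonoid)). reflexivity.
Qed.

Lemma sum_n_snd (a : nat -> C) (n : nat) :
  snd (sum_n (G := C_AbelianMonoid) a n) = sum_n (fun k => snd (a k)) n.
Proof.
  induction n as [|n IH].
  - now rewrite !sum_O.
  - rewrite sum_n_S, <- IH, (sum_Sn (G := C_AbelianMonoid)). reflexivity.
Qed.

Lemma is_series_C_iff (a : nat -> C) (l : C) :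
  is_series (K := C_AbsRing) (V := C_NormedModule) a l <->
  is_series (fun n => fst (a n)) (fst l) /\ is_series (fun n => snd (a n)) (snd l).
Proof.
  split.
  - intros H. split.
    + apply (filterlim_ext (fun n => fst (sum_n (G := C_AbelianMonoid) a n))).
      { intros n; apply sum_n_fst. }
      apply filterlim_comp with (2 := continuous_fst (fst l) (snd l)).
      rewrite <- surjective_pairing. exact H.
    + apply (filterlim_ext (fun n => snd (sum_n (G := C_AbelianMonoid) a n))).
      { intros n; apply sum_n_snd. }
      apply filterlim_comp with (2 := continuous_snd (fst l) (snd l)).
      rewrite <- surjective_pairing. exact H.
  - intros [H1 H2].
    apply (filterlim_locally (U := C_UniformSpace)). intros eps.
    pose proof (proj1 (filterlim_locally (U := R_UniformSpace) _ _) H1 eps) as E1.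
    pose proof (proj1 (filterlim_locally (U := R_UniformSpace) _ _) H2 eps) as E2.
    generalize (filter_and _ _ E1 E2). apply filter_imp. intros n [B1 B2].
    rewrite <- sum_n_fst in B1. rewrite <- sum_n_snd in B2. split; assumption.
Qed.

Lemma ex_pseries_radius (a : nat -> R) (x : R) :
  ex_pseries a x -> Rbar_le (Rabs x) (CV_radius a).
Proof.
  intros H. apply Rbar_not_lt_le. intros Hlt.
  apply (CV_disk_outside a x Hlt). apply ex_series_lim_0. now apply ex_pseries_R.
Qed.

Lemma ex_pseries_radius_lt (a : nat -> R) (r x : R) :
  (forall u, 0 < u < r -> ex_pseries a u) -> Rabs x < r -> Rbar_lt (Rabs x) (CV_radius a).
Proof.
  intros H Hx. pose proof (Rabs_pos x).
  apply Rbar_lt_le_trans with ((Rabs x + r) / 2). simpl; lra.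
  rewrite <- (Rabs_pos_eq ((Rabs x + r) / 2)) by lra.
  apply ex_pseries_radius. apply H. lra.
Qed.

(** The sum is supposed to vanish on the right of 0 only, which is what a supremum argument
    provides. Continuity at 0 gives the first coefficient; dividing the series by u shifts the
    coefficients and gives the others by induction. *)
Lemma pseries_vanishing (r : R) (k : nat) : 0 < r -> forall a : nat -> R,
  (forall u, 0 < u < r -> is_pseries a u 0) -> a k = 0.
Proof.
  intros Hr.
  assert (H0 : forall a : nat -> R, (forall u, 0 < u < r -> is_pseries a u 0) -> a 0%nat = 0).
  { intros a Ha. destruct (Req_dec (a 0%nat) 0) as [|Hne]; [assumption|exfalso].
    assert (Hc : continuity_pt (PSeries a) 0).
    { apply PSeries_continuity. apply ex_pseries_radius_lt with r.
      intros u Hu; eexists; now apply Ha. rewrite Rabs_R0; lra. }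
    destruct (Hc (Rabs (a 0%nat))) as [d [Hd Hcd]]. now apply Rabs_pos_lt.
    set (u := Rmin d r / 2).
    assert (Hu : 0 < u /\ u < d /\ u < r) by (unfold u, Rmin; destruct (Rle_dec d r); lra).
    specialize (Hcd u). simpl in Hcd. unfold R_dist in Hcd.
    rewrite PSeries_0, (is_pseries_unique _ _ _ (Ha u ltac:(lra))) in Hcd.
    rewrite Rminus_0_l, Rabs_Ropp in Hcd. apply (Rlt_irrefl (Rabs (a 0%nat))). apply Hcd.
    unfold D_x, no_cond. rewrite Rminus_0_r, Rabs_pos_eq by lra. repeat split; lra. }
  induction k as [|k IH]; intros a Ha. now apply H0.
  change (PS_decr_1 a k = 0). apply IH. intros u Hu.
  replace 0 with (scal (/ u) (plus 0 (opp (a 0%nat))) : R).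
  - apply (is_pseries_decr_1 (K := R_AbsRing) (V := R_NormedModule)).
    + change (/ u * u = 1). field. lra.
    + now apply Ha.
  - rewrite (H0 a Ha). change (/ u * (0 + - 0) = 0). ring.
Qed.

Definition real_analytic_at (h : R -> R) (t0 : R) : Prop :=
  exists (a : nat -> R) (r : R), 0 < r /\
    forall u, Rabs u < r -> is_pseries a u (h (t0 + u)).

(** Let m be the supremum of the points beyond c where h is nonzero. The expansion at m has sum zero
    on the right of m, so its coefficients vanish, and h vanishes on an interval to the left of m as
    well, against the choice of m. *)
Lemma real_analytic_identity (h : R -> R) (c b : R) :
  (forall t, c < t -> real_analytic_at h t) -> (forall t, b < t -> h t = 0) ->
  forall t, c < t -> h t = 0.
Proof.
  intros Ha Hb t1 Ht1. destruct (Req_dec (h t1) 0) as [|Hne]; [assumption|exfalso].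
  set (E := fun x => c < x /\ h x <> 0).
  destruct (completeness E) as [m [Hub Hlub]].
  - exists b. intros x [_ Hx]. destruct (Rle_dec x b); [assumption|].
    exfalso; apply Hx, Hb; lra.
  - exists t1; split; assumption.
  - assert (Hm : t1 <= m) by (apply Hub; split; assumption).
    assert (Hz : forall x, m < x -> h x = 0).
    { intros x Hx. destruct (Req_dec (h x) 0); [assumption|].
      assert (x <= m) by (apply Hub; split; [lra|assumption]). lra. }
    destruct (Ha m ltac:(lra)) as [a [r [Hr Hs]]].
    assert (Ha0 : forall k, a k = 0).
    { intros k. apply (pseries_vanishing r k Hr). intros u Hu.
      rewrite <- (Hz (m + u)) by lra. apply Hs. rewrite Rabs_pos_eq; lra. }
    assert (m <= m - r / 2); [|lra].
    apply Hlub. intros x [Hcx Hx]. destruct (Rle_dec x (m - r / 2)); [assumption|exfalso].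
    apply Hx. destruct (Rlt_dec m x). now apply Hz.
    replace x with (m + (x - m)) by ring.
    rewrite <- (is_pseries_unique _ _ _ (Hs (x - m) ltac:(apply Rabs_def1; lra))).
    rewrite (PSeries_ext a (fun _ => 0)) by apply Ha0. apply PSeries_const_0.
Qed.

Lemma real_analytic_ext (f g : R -> R) (t0 : R) :
  (forall t, f t = g t) -> real_analytic_at f t0 -> real_analytic_at g t0.
Proof.
  intros E (a & r & Hr & H). exists a, r. split; [assumption|].
  intros u Hu. rewrite <- E. now apply H.
Qed.

Lemma real_analytic_const (c t0 : R) : real_analytic_at (fun _ => c) t0.
Proof.
  exists (fun k => match k with O => c | _ => 0 end), 1. split. lra. intros u _.
  apply is_pseries_R. apply is_lim_seq_of_is_series.
  apply is_lim_seq_ext with (fun _ => c); [|apply is_lim_seq_const].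
  induction n. rewrite sum_O; simpl; ring. rewrite sum_n_S, <- IHn; simpl; ring.
Qed.

Lemma real_analytic_plus (f g : R -> R) (t0 : R) :
  real_analytic_at f t0 -> real_analytic_at g t0 -> real_analytic_at (fun t => f t + g t) t0.
Proof.
  intros (a & r & Hr & H) (b & r' & Hr' & H'). exists (PS_plus a b), (Rmin r r').
  split. now apply Rmin_glb_lt.
  intros u Hu. apply (is_pseries_plus (K := R_AbsRing) (V := R_NormedModule)).
  - apply H. apply Rlt_le_trans with (1 := Hu), Rmin_l.
  - apply H'. apply Rlt_le_trans with (1 := Hu), Rmin_r.
Qed.

Lemma real_analytic_scal (f : R -> R) (c t0 : R) :
  real_analytic_at f t0 -> real_analytic_at (fun t => c * f t) t0.
Proof.
  intros (a & r & Hr & H). exists (PS_scal c a), r. split; [assumption|].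
  intros u Hu. apply (is_pseries_scal (K := R_AbsRing) (V := R_NormedModule)).
  apply Rmult_comm. now apply H.
Qed.

Lemma real_analytic_mul_id (f : R -> R) (t0 : R) :
  real_analytic_at f t0 -> real_analytic_at (fun t => t * f t) t0.
Proof.
  intros (a & r & Hr & H). exists (PS_plus (PS_scal t0 a) (PS_incr_1 a)), r. split; [assumption|].
  intros u Hu. rewrite Rmult_plus_distr_r.
  apply (is_pseries_plus (K := R_AbsRing) (V := R_NormedModule)).
  - apply (is_pseries_scal (K := R_AbsRing) (V := R_NormedModule)).
    apply Rmult_comm. now apply H.
  - apply (is_pseries_incr_1 (K := R_AbsRing) (V := R_NormedModule)). now apply H.
Qed.

(** Degree three suffices because s (s+1) (1-s) is the polynomial factor of highest degree in the
    identity for B(s). *)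
Lemma real_analytic_mul_cubic (f : R -> R) (c0 c1 c2 c3 t0 : R) :
  real_analytic_at f t0 ->
  real_analytic_at (fun t => (c0 + c1 * t + c2 * t ^ 2 + c3 * t ^ 3) * f t) t0.
Proof.
  intros H.
  apply real_analytic_ext with
    (fun t => c0 * f t + (c1 * (t * f t) + (c2 * (t * (t * f t)) + c3 * (t * (t * (t * f t)))))).
  { intros t. ring. }
  repeat apply real_analytic_plus; apply real_analytic_scal;
    repeat apply real_analytic_mul_id; assumption.
Qed.

Lemma real_analytic_continuous (h : R -> R) (t0 : R) :
  real_analytic_at h t0 -> continuous h t0.
Proof.
  intros (a & r & Hr & H).
  apply continuous_ext_loc with (fun t => PSeries a (t - t0)).
  - exists (mkposreal r Hr). intros t Ht. apply is_pseries_unique.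
    replace t with (t0 + (t - t0)) at 2 by ring. apply H. exact Ht.
  - apply (continuous_comp (fun t => t - t0) (PSeries a)).
    + apply continuous_of_ex_derive. auto_derive. exact I.
    + apply continuity_pt_filterlim, PSeries_continuity. rewrite Rminus_diag.
      apply ex_pseries_radius_lt with r. intros u Hu. eexists. apply H. rewrite Rabs_pos_eq; lra.
      rewrite Rabs_R0; lra.
Qed.

(** Putting s = s0 + u d turns the coefficients into d^k a_k. The bounds on the parts of d keep u d
    in the product ball of radius eps as soon as |u| < eps. It serves for d = 1 and d = i. *)
Lemma analytic_at_along_line (f : C -> C) (s0 d : C) :
  Rabs (fst d) <= 1 -> Rabs (snd d) <= 1 -> analytic_at f s0 ->
  real_analytic_at (fun t => fst (f (Cplus s0 (Cmult (RtoC t) d)))) 0 /\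
  real_analytic_at (fun t => snd (f (Cplus s0 (Cmult (RtoC t) d)))) 0.
Proof.
  intros Hd1 Hd2 (a & eps & Ha).
  assert (Hser : forall u, Rabs u < eps ->
    is_series (K := C_AbsRing) (V := C_NormedModule)
      (fun k => Cmult (RtoC (u ^ k)) (Cmult (pow_n (K := C_Ring) d k) (a k))) (f (Cplus s0 (Cmult (RtoC u) d)))).
  { intros u Hu. assert (Hb : ball (M := C_UniformSpace) s0 eps (Cplus s0 (Cmult (RtoC u) d))).
    { pose proof (Rabs_pos u). pose proof (Rabs_pos (fst d)). pose proof (Rabs_pos (snd d)).
      split; simpl; unfold ball; simpl; unfold AbsRing_ball, abs, minus, plus, opp; simpl.
      - replace (fst s0 + (u * fst d - 0 * snd d) + - fst s0) with (u * fst d) by ring.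
        rewrite Rabs_mult. nra.
      - replace (snd s0 + (u * snd d + 0 * fst d) + - snd s0) with (u * snd d) by ring.
        rewrite Rabs_mult. nra. }
    specialize (Ha _ Hb). unfold is_pseries in Ha.
    eapply is_series_ext; [|exact Ha].
    intros k.
    assert (E : Cminus (Cplus s0 (Cmult (RtoC u) d)) s0 = Cmult (RtoC u) d) by ring.
    rewrite E. clear E.
    change (Cmult (pow_n (K := C_Ring) (Cmult (RtoC u) d) k) (a k) =
      Cmult (RtoC (u ^ k)) (Cmult (pow_n (K := C_Ring) d k) (a k))).
    rewrite Cmult_assoc. apply (f_equal (fun z => Cmult z (a k))).
    induction k as [|k IH].
    - change (pow_n (K := C_Ring) (Cmult (RtoC u) d) 0) with (RtoC 1).
      change (pow_n (K := C_Ring) d 0) with (RtoC 1). simpl; ring.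
    - change (pow_n (K := C_Ring) (Cmult (RtoC u) d) (S k)) with
        (Cmult (Cmult (RtoC u) d) (pow_n (K := C_Ring) (Cmult (RtoC u) d) k)).
      change (pow_n (K := C_Ring) d (S k)) with (Cmult d (pow_n (K := C_Ring) d k)).
      rewrite IH. simpl pow. rewrite RtoC_mult. ring. }
  split.
  - exists (fun k => fst (Cmult (pow_n (K := C_Ring) d k) (a k))), eps. split. apply cond_pos.
    intros u Hu. rewrite Rplus_0_l. apply is_pseries_R.
    destruct (proj1 (is_series_C_iff _ _) (Hser u Hu)) as [H1 _].
    eapply is_series_ext; [|exact H1]. intros k; simpl; ring.
  - exists (fun k => snd (Cmult (pow_n (K := C_Ring) d k) (a k))), eps. split. apply cond_pos.
    intros u Hu. rewrite Rplus_0_l. apply is_pseries_R.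
    destruct (proj1 (is_series_C_iff _ _) (Hser u Hu)) as [_ H1].
    eapply is_series_ext; [|exact H1]. intros k; simpl; ring.
Qed.

(** * The weighted cell sums B(s) *)


Lemma ln_INR_infty : is_lim_seq (fun n => ln (INR (S n))) p_infty.
Proof.
  apply (is_lim_comp_seq ln (fun n => INR (S n)) p_infty p_infty).
  - apply is_lim_ln_p.
  - exists 0%nat. intros; discriminate.
  - apply is_lim_seq_incr_1 with (u := INR). apply is_lim_seq_INR.
Qed.

Lemma exp_ln_INR_0 (d : R) : 0 < d -> is_lim_seq (fun n => exp (- d * ln (INR (S n)))) 0.
Proof.
  intros Hd.
  apply (is_lim_comp_seq exp (fun n => - d * ln (INR (S n))) m_infty 0).
  - apply is_lim_exp_m.
  - exists 0%nat. intros; discriminate.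
  - replace m_infty with (Rbar_mult (- d) p_infty).
    apply is_lim_seq_scal_l, ln_INR_infty.
    simpl. destruct (Rle_dec 0 (- d)) as [h|h]; [exfalso; lra|reflexivity].
Qed.

Lemma is_series_telescope (f : nat -> R) (l : R) :
  is_lim_seq f l -> is_series (fun n => f n - f (S n)) (f 0%nat - l).
Proof.
  intros H. apply is_lim_seq_of_is_series.
  apply is_lim_seq_ext with (fun n => f 0%nat - f (S n)).
  { induction n. now rewrite sum_O. rewrite sum_n_S, <- IHn. ring. }
  apply is_lim_seq_minus'. apply is_lim_seq_const. now apply is_lim_seq_incr_1 in H.
Qed.

(** The weight vanishes at both ends of the cell and has second derivative -2, so two integrations
    by parts leave the end values of the trapezoidal rule and a plain integral. On the cell it lies
    between 0 and 1. *)
Definition cell_integral (n : nat) (h : R -> R) : R :=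
  RInt (fun v => (v - INR n) * (INR n + 1 - v) * h v) (INR n) (INR n + 1).

Definition cell_sum (h : R -> R) : R := Series (fun n => cell_integral (S n) h).

(** The majorant K v^(-d-1) is written so that -(K/d) v^(-d) is visibly a primitive; its cell
    integrals telescope, which bounds [cell_sum h] by K/d for d > 0. Only v >= 1 is mentioned
    because the cells of [cell_sum] start at 1. *)
Definition cell_dominated (d K : R) (h : R -> R) : Prop :=
  (forall v, 1 <= v -> continuous h v) /\
  (forall v, 1 <= v -> Rabs (h v) <= K * (exp (- d * ln v) / v)).

Lemma cell_integrable (n : nat) (h : R -> R) : (forall v, 1 <= v -> continuous h v) ->
  ex_RInt (fun v => (v - INR (S n)) * (INR (S n) + 1 - v) * h v) (INR (S n)) (INR (S n) + 1).
Proof.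
  intros Hc. apply (ex_RInt_continuous (V := R_CompleteNormedModule)).
  intros v Hv. rewrite Rmin_left, Rmax_right in Hv by lra.
  assert (1 <= INR (S n)) by (rewrite S_INR; pose proof (pos_INR n); lra).
  apply (continuous_mult (fun v => (v - INR (S n)) * (INR (S n) + 1 - v)) h).
  - apply continuous_of_ex_derive. auto_derive. exact I.
  - apply Hc; lra.
Qed.

Lemma cell_integral_bound (d K : R) (h : R -> R) (n : nat) : 0 < d -> cell_dominated d K h ->
  Rabs (cell_integral (S n) h) <=
    K / d * (exp (- d * ln (INR (S n))) - exp (- d * ln (INR (S (S n))))).
Proof.
  intros Hd [Hc Hb]. unfold cell_integral.
  assert (Hn : 1 <= INR (S n)) by (rewrite S_INR; pose proof (pos_INR n); lra).
  rewrite (S_INR (S n)). set (N := INR (S n)) in *.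
  assert (Hex := cell_integrable n h Hc). fold N in Hex.
  eapply Rle_trans; [apply abs_RInt_le; [lra|exact Hex]|].
  assert (Hd1 : forall v, 1 <= v -> is_derive (fun v => - (K / d) * exp (- d * ln v)) v (K * (exp (- d * ln v) / v))).
  { intros v Hv. auto_derive. lra. field. lra. }
  assert (Hc1 : forall v, 1 <= v -> continuous (fun v => K * (exp (- d * ln v) / v)) v).
  { intros v Hv. apply continuous_of_ex_derive. auto_derive. repeat split; lra. }
  replace (K / d * (exp (- d * ln N) - exp (- d * ln (N + 1)))) with
    (RInt (fun v => K * (exp (- d * ln v) / v)) N (N + 1)).
  - apply RInt_le. lra. now apply (ex_RInt_norm (fun v => (v - N) * (N + 1 - v) * h v)).
    + apply (ex_RInt_continuous (V := R_CompleteNormedModule)).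
      intros v Hv. rewrite Rmin_left, Rmax_right in Hv by lra. apply Hc1; lra.
    + intros v Hv. rewrite Rabs_mult. specialize (Hb v ltac:(lra)).
      assert (0 <= (v - N) * (N + 1 - v) <= 1) by nra.
      rewrite (Rabs_pos_eq ((v - N) * (N + 1 - v))) by lra.
      pose proof (Rabs_pos (h v)). nra.
  - rewrite (RInt_FTC (fun v => - (K / d) * exp (- d * ln v))).
    + eq_R. ring.
    + intros v Hv. rewrite Rmin_left, Rmax_right in Hv by lra. apply Hd1; lra.
    + intros v Hv. rewrite Rmin_left, Rmax_right in Hv by lra. apply Hc1; lra.
Qed.

Lemma cell_majorant_series (d K : R) : 0 < d ->
  is_series (fun n => K / d * (exp (- d * ln (INR (S n))) - exp (- d * ln (INR (S (S n)))))) (K / d).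
Proof.
  intros Hd. pose proof (is_series_telescope _ _ (exp_ln_INR_0 d Hd)) as H.
  replace (K / d) with (K / d * (exp (- d * ln (INR 1)) - 0)) at 1.
  - exact (is_series_scal (K := R_AbsRing) (V := R_NormedModule) (K / d) _ _ H).
  - simpl INR. rewrite ln_1, Rmult_0_r, exp_0. ring.
Qed.

Lemma cell_sum_abs_ex (d K : R) (h : R -> R) : 0 < d -> cell_dominated d K h ->
  ex_series (fun n => Rabs (cell_integral (S n) h)).
Proof.
  intros Hd Hh.
  apply (ex_series_le (K := R_AbsRing) (V := R_CompleteNormedModule)) with
    (b := fun n => K / d * (exp (- d * ln (INR (S n))) - exp (- d * ln (INR (S (S n)))))).
  - intros n. change (Rabs (Rabs (cell_integral (S n) h)) <=
      K / d * (exp (- d * ln (INR (S n))) - exp (- d * ln (INR (S (S n)))))).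
    rewrite Rabs_Rabsolu. now apply cell_integral_bound.
  - eexists; now apply cell_majorant_series.
Qed.

Lemma cell_sum_correct (d K : R) (h : R -> R) : 0 < d -> cell_dominated d K h ->
  is_series (fun n => cell_integral (S n) h) (cell_sum h).
Proof.
  intros Hd Hh. apply Series_correct, ex_series_Rabs. now apply cell_sum_abs_ex with d K.
Qed.

Lemma cell_sum_bound (d K : R) (h : R -> R) : 0 < d -> cell_dominated d K h ->
  Rabs (cell_sum h) <= K / d.
Proof.
  intros Hd Hh. unfold cell_sum.
  apply Rle_trans with (1 := Series_Rabs _ (cell_sum_abs_ex d K h Hd Hh)).
  rewrite <- (is_series_unique _ _ (cell_majorant_series d K Hd)).
  apply Series_le.
  - intros n. split. apply Rabs_pos. now apply cell_integral_bound.
  - eexists; now apply cell_majorant_series.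
Qed.

Lemma cell_dominated_sub_mul (d K K' k : R) (h g : R -> R) :
  cell_dominated d K h -> cell_dominated d K' g ->
  cell_dominated d (K + Rabs k * K') (fun v => h v - k * g v).
Proof.
  intros [Hc Hb] [Hc' Hb']. split.
  - intros v Hv. apply (continuous_minus (V := R_NormedModule) h (fun v => k * g v)). now apply Hc.
    apply (continuous_mult (K := R_AbsRing) (fun _ => k) g). apply continuous_const. now apply Hc'.
  - intros v Hv. specialize (Hb v Hv). specialize (Hb' v Hv).
    apply Rle_trans with (Rabs (h v) + Rabs (k * g v)).
    + unfold Rminus. rewrite <- (Rabs_Ropp (k * g v)). apply Rabs_triang.
    + rewrite Rabs_mult. pose proof (Rabs_pos k). nra.
Qed.

Lemma cell_sum_sub_mul (d K K' k : R) (h g : R -> R) : 0 < d ->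
  cell_dominated d K h -> cell_dominated d K' g ->
  cell_sum (fun v => h v - k * g v) = cell_sum h - k * cell_sum g.
Proof.
  intros Hd Hh Hg. apply is_series_unique.
  pose proof (cell_sum_correct d K h Hd Hh) as H1.
  pose proof (cell_sum_correct d K' g Hd Hg) as H2.
  apply (is_series_scal (K := R_AbsRing) (V := R_NormedModule) k) in H2.
  pose proof (is_series_minus _ _ _ _ H1 H2) as H3.
  eapply is_series_ext; [|exact H3]. intros n.
  change (cell_integral (S n) h - k * cell_integral (S n) g = cell_integral (S n) (fun v => h v - k * g v)).
  symmetry. unfold cell_integral at 1. apply is_RInt_unique.
  eapply is_RInt_ext; [|apply is_RInt_sub; [|apply is_RInt_mul];
    apply RInt_of_ex, cell_integrable; [apply Hh|apply Hg]].
  intros v _. cbv beta. eq_R. ring.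
Qed.

(** For k > M, |x|^k <= rho^k y^k <= rho^(M+1) y^k compares the tail with that of exp y. With x = -u
    ln v and y = d ln v the remainder becomes geometric in M uniformly in v, at the cost of a factor
    v^d. *)
Lemma exp_tail_bound (x y rho : R) (M : nat) :
  0 <= y -> 0 <= rho <= 1 -> Rabs x <= rho * y ->
  Rabs (exp x - sum_n (fun m => x ^ m / INR (fact m)) M) <= rho ^ (S M) * exp y.
Proof.
  intros Hy Hr Hx.
  assert (He : forall z, is_series (fun m => z ^ m / INR (fact m)) (exp z)).
  { intros z. pose proof (proj1 (is_pseries_R _ _ _) (is_exp_Reals z)) as H.
    eapply is_series_ext; [|exact H]. intros n; cbv beta. eq_R. field. apply INR_fact_neq_0. }
  assert (Hterm : forall k, 0 <= Rabs (x ^ (S M + k) / INR (fact (S M + k))) <=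
     rho ^ (S M) * (y ^ (S M + k) / INR (fact (S M + k)))).
  { intros k. split. apply Rabs_pos. pose proof (INR_fact_lt_0 (S M + k)).
    unfold Rdiv. rewrite Rabs_mult, <- RPow_abs, Rabs_inv, (Rabs_pos_eq (INR _)) by lra.
    rewrite <- Rmult_assoc. apply Rmult_le_compat_r. apply Rlt_le, Rinv_0_lt_compat; assumption.
    apply Rle_trans with ((rho * y) ^ (S M + k)).
    - apply pow_incr. split. apply Rabs_pos. assumption.
    - rewrite Rpow_mult_distr. apply Rmult_le_compat_r. now apply pow_le.
      rewrite pow_add. rewrite <- (Rmult_1_r (rho ^ S M)) at 2. apply Rmult_le_compat_l. now apply pow_le.
      rewrite <- (pow1 k). apply pow_incr. assumption. }
  assert (Hey : ex_series (fun k => y ^ (S M + k) / INR (fact (S M + k)))).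
  { apply (ex_series_incr_n (K := R_AbsRing) (V := R_NormedModule) (fun k => y ^ k / INR (fact k))).
    eexists; apply He. }
  assert (Hmaj : ex_series (fun k => rho ^ (S M) * (y ^ (S M + k) / INR (fact (S M + k))))).
  { now apply (ex_series_scal (K := R_AbsRing) (V := R_NormedModule)). }
  assert (Hsx : ex_series (fun k => Rabs (x ^ (S M + k) / INR (fact (S M + k))))).
  { eapply (ex_series_le (K := R_AbsRing) (V := R_CompleteNormedModule)); [|exact Hmaj].
    intros k. change (Rabs (Rabs (x ^ (S M + k) / INR (fact (S M + k)))) <=
      rho ^ (S M) * (y ^ (S M + k) / INR (fact (S M + k)))).
    rewrite Rabs_Rabsolu. apply Hterm. }
  replace (exp x - sum_n (fun m => x ^ m / INR (fact m)) M)
    with (Series (fun k => x ^ (S M + k) / INR (fact (S M + k)))).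
  - apply Rle_trans with (1 := Series_Rabs _ Hsx).
    apply Rle_trans with (1 := Series_le _ _ Hterm Hmaj).
    rewrite Series_scal_l. apply Rmult_le_compat_l. now apply pow_le.
    rewrite <- (is_series_unique _ _ (He y)), (Series_incr_n (fun m => y ^ m / INR (fact m)) (S M)) by (try lia; eexists; apply He).
    rewrite <- (Rplus_0_l (Series _)) at 1. apply Rplus_le_compat_r.
    apply cond_pos_sum. intros k. apply Rdiv_le_0_compat. now apply pow_le. apply INR_fact_lt_0.
  - rewrite <- (is_series_unique _ _ (He x)), (Series_incr_n (fun m => x ^ m / INR (fact m)) (S M)) by (try lia; eexists; apply He).
    rewrite sum_n_Reals. simpl Init.Nat.pred. ring.
Qed.


Lemma exp_ln_scaled_pos (v z : R) : 1 <= v -> 0 <= z -> 0 <= z * ln v.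
Proof.
  intros Hv Hz. apply Rmult_le_pos; [assumption|]. rewrite <- ln_1. apply ln_le; lra.
Qed.

Lemma pow_div_fact_le_exp (y : R) (m : nat) : 0 <= y -> y ^ m / INR (fact m) <= exp y.
Proof.
  intros Hy.
  pose proof (proj1 (is_pseries_R _ _ _) (is_exp_Reals y)) as H.
  assert (Hp : forall k, 0 <= / INR (fact k) * y ^ k).
  { intros k. apply Rmult_le_pos. apply Rlt_le, Rinv_0_lt_compat, INR_fact_lt_0. now apply pow_le. }
  apply Rle_trans with (sum_n (fun k => / INR (fact k) * y ^ k) m).
  - destruct m. rewrite sum_O. simpl; lra.
    rewrite sum_n_S. assert (0 <= sum_n (fun k => / INR (fact k) * y ^ k) m); [|unfold Rdiv; lra].
    rewrite sum_n_Reals. now apply cond_pos_sum.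
  - apply (is_lim_seq_incr_compare (sum_n (fun k => / INR (fact k) * y ^ k))); [exact H|].
    intros n. rewrite sum_n_S. specialize (Hp (S n)). lra.
Qed.

(* The Mellin-type integrand carries a factor [v^-(t+2)]; half of the available decay [t0+1]
   pays for the expansion of [v^-u], the rest for summability. *)
Lemma cell_sum_power_analytic (c : R -> R) (t0 : R) :
  (forall v, 1 <= v -> continuous c v) -> (forall v, Rabs (c v) <= 1) -> -1 < t0 ->
  real_analytic_at (fun t => cell_sum (fun v => exp (- (t + 2) * ln v) * c v)) t0.
Proof.
  intros Hc Hc1 Ht0. set (d := (t0 + 1) / 2). assert (Hd : 0 < d) by (unfold d; lra).
  (* Integrands of the Taylor coefficients, from the expansion of v^(-u) in powers of u. Since (d ln
     v)^m / m! <= v^d, [g m] is dominated with constant d^(-m), which allows |u| < d. *)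
  set (g := fun m v => exp (- (t0 + 2) * ln v) * ((- ln v) ^ m / INR (fact m)) * c v).
  assert (Hsplit : forall v, 1 <= v -> exp (- (t0 + 2) * ln v) = exp (- d * ln v) / v * exp (- (d * ln v))).
  { intros v Hv. replace (exp (- d * ln v) / v) with (exp (- d * ln v) * exp (- ln v)).
    rewrite <- !exp_plus. f_equal. unfold d. field.
    rewrite exp_Ropp, exp_ln by lra. reflexivity. }
  assert (Hcont : forall (f : R -> R) v, 1 <= v -> ex_derive f v ->
     continuous (fun v => exp (- (t0 + 2) * ln v) * f v * c v) v).
  { intros f v Hv Hf.
    apply (continuous_mult (fun v => exp (- (t0 + 2) * ln v) * f v) c); [|now apply Hc].
    apply continuous_of_ex_derive. auto_derive. repeat split; auto; lra. }
  assert (Hg : forall m, cell_dominated d (/ d ^ m) (g m)).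
  { intros m. split.
    - intros v Hv. apply Hcont. assumption. auto_derive. lra.
    - intros v Hv. unfold g. rewrite Hsplit by assumption.
      rewrite !Rabs_mult. specialize (Hc1 v).
      assert (Hl : 0 <= ln v) by (pose proof (exp_ln_scaled_pos v 1 Hv); lra).
      assert (Hy := pow_div_fact_le_exp (d * ln v) m ltac:(now apply Rmult_le_pos; lra)).
      assert (Hp : 0 < exp (- d * ln v) / v) by (apply Rdiv_lt_0_compat; [apply exp_pos|lra]).
      rewrite (Rabs_pos_eq _ (Rlt_le _ _ Hp)), (Rabs_pos_eq _ (Rlt_le _ _ (exp_pos _))).
      unfold Rdiv at 2. rewrite Rabs_mult, <- RPow_abs, Rabs_Ropp, (Rabs_pos_eq (ln v)),
        (Rabs_pos_eq (/ _)) by (try assumption; apply Rlt_le, Rinv_0_lt_compat, INR_fact_lt_0).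
      assert (Hk : exp (- (d * ln v)) * (ln v ^ m * / INR (fact m)) <= / d ^ m).
      { pose proof (pow_lt d m Hd). apply (Rmult_le_reg_l (d ^ m)); [assumption|].
        rewrite Rinv_r by lra.
        replace (d ^ m * (exp (- (d * ln v)) * (ln v ^ m * / INR (fact m)))) with
          (exp (- (d * ln v)) * ((d * ln v) ^ m / INR (fact m))) by (rewrite Rpow_mult_distr; unfold Rdiv; ring).
        apply Rle_trans with (exp (- (d * ln v)) * exp (d * ln v)).
        apply Rmult_le_compat_l; [apply Rlt_le, exp_pos|assumption].
        rewrite <- exp_plus. rewrite Rplus_opp_l, exp_0. lra. }
      assert (0 <= exp (- (d * ln v)) * (ln v ^ m * / INR (fact m))).
      { apply Rmult_le_pos. apply Rlt_le, exp_pos. apply Rmult_le_pos. now apply pow_le.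
        apply Rlt_le, Rinv_0_lt_compat, INR_fact_lt_0. }
      pose proof (Rabs_pos (c v)).
      apply Rle_trans with (exp (- d * ln v) / v * (exp (- (d * ln v)) * (ln v ^ m * / INR (fact m))) * 1).
      + rewrite (Rmult_assoc (exp (- d * ln v) / v)).
        apply Rmult_le_compat_l; [apply Rmult_le_pos; lra|assumption].
      + rewrite Rmult_1_r, Rmult_comm. apply Rmult_le_compat_r; lra. }
  exists (fun m => cell_sum (g m)), d. split; [assumption|]. intros u Hu.
  set (hu := fun v => exp (- (t0 + u + 2) * ln v) * c v).
  set (rem := fun M v => exp (- (t0 + 2) * ln v) *
     (exp (- u * ln v) - sum_n (fun m => (- u * ln v) ^ m / INR (fact m)) M) * c v).
  set (rho := Rabs u / d).
  assert (Hrho : 0 <= rho < 1).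
  { unfold rho. split. apply Rdiv_le_0_compat; [apply Rabs_pos|assumption].
    apply Rlt_div_l; lra. }
  assert (Hrem : forall M, cell_dominated d (rho ^ (S M)) (rem M)).
  { intros M. split.
    - intros v Hv. apply Hcont; [assumption|].
      apply (ex_derive_minus (K := R_AbsRing) (V := R_NormedModule)). auto_derive; lra.
      apply (ex_derive_sum_n (K := R_AbsRing) (V := R_NormedModule) (fun m v => (- u * ln v) ^ m / INR (fact m))).
      intros k _. auto_derive; lra.
    - intros v Hv. unfold rem. rewrite Hsplit by assumption.
      rewrite !Rabs_mult. specialize (Hc1 v). pose proof (Rabs_pos (c v)).
      assert (Hl : 0 <= ln v) by (pose proof (exp_ln_scaled_pos v 1 Hv); lra).
      assert (Hp : 0 < exp (- d * ln v) / v) by (apply Rdiv_lt_0_compat; [apply exp_pos|lra]).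
      rewrite (Rabs_pos_eq _ (Rlt_le _ _ Hp)), (Rabs_pos_eq _ (Rlt_le _ _ (exp_pos _))).
      assert (HT := exp_tail_bound (- u * ln v) (d * ln v) rho M ltac:(now apply Rmult_le_pos; lra) ltac:(lra)).
      set (T := Rabs (exp (- u * ln v) - _)) in *.
      assert (HT' : T <= rho ^ S M * exp (d * ln v)).
      { apply HT. rewrite Rabs_mult, Rabs_Ropp, (Rabs_pos_eq (ln v)) by assumption.
        unfold rho. apply Req_le. field. lra. }
      assert (HTp : 0 <= T) by apply Rabs_pos.
      assert (HE : exp (- (d * ln v)) * exp (d * ln v) = 1)
        by (rewrite <- exp_plus, Rplus_opp_l; apply exp_0).
      pose proof (exp_pos (- (d * ln v))).
      assert (HT2 : exp (- (d * ln v)) * T <= rho ^ S M).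
      { apply Rle_trans with (exp (- (d * ln v)) * (rho ^ S M * exp (d * ln v))).
        apply Rmult_le_compat_l; lra.
        replace (exp (- (d * ln v)) * (rho ^ S M * exp (d * ln v))) with
         (rho ^ S M * (exp (- (d * ln v)) * exp (d * ln v))) by ring. rewrite HE. lra. }
      assert (0 <= exp (- (d * ln v)) * T) by (apply Rmult_le_pos; lra).
      apply Rle_trans with (exp (- d * ln v) / v * (exp (- (d * ln v)) * T) * 1).
      + rewrite (Rmult_assoc (exp (- d * ln v) / v)).
        apply Rmult_le_compat_l; [apply Rmult_le_pos; lra|assumption].
      + rewrite Rmult_1_r, Rmult_comm. apply Rmult_le_compat_r; lra. }
  assert (Hfac : forall v, hu v = exp (- (t0 + 2) * ln v) * exp (- u * ln v) * c v).
  { intros v. unfold hu. rewrite <- exp_plus. f_equal. f_equal. ring. }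
  assert (Hgu : forall m v, u ^ m * g m v = exp (- (t0 + 2) * ln v) * ((- u * ln v) ^ m / INR (fact m)) * c v).
  { intros m v. unfold g. replace (- u * ln v) with (u * (- ln v)) by ring.
    rewrite Rpow_mult_distr. unfold Rdiv. ring. }
  assert (Hsum : forall M, cell_sum (rem M) = cell_sum hu - sum_n (fun m => cell_sum (g m) * u ^ m) M).
  { assert (Hext : forall h1 h2, (forall v, h1 v = h2 v) -> cell_sum h1 = cell_sum h2).
    { intros h1 h2 E. apply Series_ext. intros n. apply RInt_ext. intros v _. now rewrite E. }
    (* [hu] equals [rem 0 + g 0], so its domination follows from the two already known; the factor
       -1 adapts the sum to the lemma on differences. *)
    assert (Hhu : cell_dominated d (rho ^ 1 + Rabs (- 1) * / d ^ 0) hu).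
    { pose proof (cell_dominated_sub_mul d _ _ (- 1) _ _ (Hrem 0%nat) (Hg 0%nat)) as [H1 H2].
      assert (E : forall v, rem 0%nat v - -1 * g 0%nat v = hu v).
      { intros v. rewrite Hfac. unfold rem, g. rewrite sum_O. simpl. field. }
      split; intros v Hv.
      - apply continuous_ext with (2 := H1 v Hv). exact E.
      - rewrite <- E. now apply H2. }
    induction M as [|M IH].
    - rewrite sum_O, Rmult_comm, <- (cell_sum_sub_mul d _ _ (u ^ 0) _ _ Hd Hhu (Hg 0%nat)).
      apply Hext. intros v. rewrite Hfac, Hgu. unfold rem. rewrite sum_O. ring.
    - rewrite sum_n_S.
      replace (cell_sum hu - (sum_n (fun m => cell_sum (g m) * u ^ m) M + cell_sum (g (S M)) * u ^ S M))
        with (cell_sum hu - sum_n (fun m => cell_sum (g m) * u ^ m) M - u ^ S M * cell_sum (g (S M))) by ring.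
      rewrite <- IH, <- (cell_sum_sub_mul d _ _ (u ^ S M) _ _ Hd (Hrem M) (Hg (S M))).
      apply Hext. intros v. rewrite Hgu. unfold rem. rewrite sum_n_S. ring. }
  apply is_pseries_R, is_lim_seq_of_is_series. change (cell_sum (fun v => exp (- (t0 + u + 2) * ln v) * c v)) with (cell_sum hu).
  apply is_lim_seq_ext with (fun M => cell_sum hu - cell_sum (rem M)).
  { intros M. rewrite Hsum. ring. }
  replace (Finite (cell_sum hu)) with (Finite (cell_sum hu - 0)) by (f_equal; ring).
  apply is_lim_seq_minus'. apply is_lim_seq_const.
  apply is_lim_seq_abs_0.
  apply is_lim_seq_le_le with (fun _ => 0) (fun M => / d * rho ^ (S M)).
  - intros M. split. apply Rabs_pos. rewrite Rmult_comm. now apply cell_sum_bound.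
  - apply is_lim_seq_const.
  - replace (Finite 0) with (Rbar_mult (/ d) 0) by (simpl; f_equal; ring).
    apply is_lim_seq_scal_l. apply (is_lim_seq_incr_1 (fun M => rho ^ M)).
    apply is_lim_seq_geom. rewrite Rabs_pos_eq; lra.
Qed.


(* With [s = t + i y], this is the real part of
   [s (s+1) (1-s) w v^(-s-2) = d/dv (- s (1-s) w v^(-s-1) - (1-s) w' v^-s - 2 v^(1-s))],
   [w = (v-n)(n+1-v)], rotated by the phase [phi] so that the imaginary part is covered too. *)
Lemma cell_integral_by_parts (t y phi : R) (n : nat) :
  (t - t ^ 3 + 3 * t * y ^ 2) * cell_integral (S n) (fun v => exp (- (t + 2) * ln v) * cos (y * ln v + phi))
  + (y + y ^ 3 - 3 * t ^ 2 * y) * cell_integral (S n) (fun v => exp (- (t + 2) * ln v) * sin (y * ln v + phi))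
  = (fun v => exp (- t * ln v) * ((1 - t) * cos (y * ln v + phi) - y * sin (y * ln v + phi))) (INR (S (S n)))
  + (fun v => exp (- t * ln v) * ((1 - t) * cos (y * ln v + phi) - y * sin (y * ln v + phi))) (INR (S n))
  - 2 * ((fun v => v * (exp (- t * ln v) * cos (y * ln v + phi))) (INR (S (S n)))
         - (fun v => v * (exp (- t * ln v) * cos (y * ln v + phi))) (INR (S n))).
Proof.
  assert (Hn : 1 <= INR (S n)) by (rewrite S_INR; pose proof (pos_INR n); lra).
  rewrite (S_INR (S n)). set (N := INR (S n)) in *.
  (* [al] and [be] are the real and imaginary parts of s (s+1) (1-s) = s - s^3. The phase of v^(-s)
     is -y ln v, so both enter the real part with a plus sign. *)
  set (al := t - t ^ 3 + 3 * t * y ^ 2). set (be := y + y ^ 3 - 3 * t ^ 2 * y).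
  set (P := fun v => - ((t - t ^ 2 + y ^ 2) * cos (y * ln v + phi) + (y - 2 * t * y) * sin (y * ln v + phi))
               * exp (- t * ln v) * ((v - N) * (N + 1 - v)) / v
     - (2 * N + 1 - 2 * v) * (exp (- t * ln v) * ((1 - t) * cos (y * ln v + phi) - y * sin (y * ln v + phi)))
     - 2 * v * (exp (- t * ln v) * cos (y * ln v + phi))).
  set (h := fun v => al * ((v - N) * (N + 1 - v) * (exp (- (t + 2) * ln v) * cos (y * ln v + phi)))
     - (- be) * ((v - N) * (N + 1 - v) * (exp (- (t + 2) * ln v) * sin (y * ln v + phi)))).
  assert (Hcont : forall (f : R -> R), (forall v, ex_derive f v) ->
    forall v, 1 <= v -> continuous (fun v => exp (- (t + 2) * ln v) * f (y * ln v + phi)) v).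
  { intros f Hf v Hv. apply continuous_of_ex_derive. auto_derive. repeat split; auto; lra. }
  assert (E1 : RInt h N (N + 1) = P (N + 1) - P N).
  { apply RInt_FTC; intros v Hv; rewrite Rmin_left, Rmax_right in Hv by lra.
    - unfold P, h. auto_derive. repeat split; lra.
      replace (exp (- (t + 2) * ln v)) with (exp (- t * ln v) / v ^ 2).
      unfold al, be. field. lra.
      replace (- (t + 2) * ln v) with (- t * ln v + (- ln v + - ln v)) by ring.
      rewrite !exp_plus, exp_Ropp, exp_ln by lra. field. lra.
    - unfold h. apply continuous_of_ex_derive. auto_derive. repeat split; lra. }
  assert (E2 : RInt h N (N + 1) = al * cell_integral (S n) (fun v => exp (- (t + 2) * ln v) * cos (y * ln v + phi))
     - (- be) * cell_integral (S n) (fun v => exp (- (t + 2) * ln v) * sin (y * ln v + phi))).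
  { apply is_RInt_unique. unfold h, cell_integral. fold N.
    apply is_RInt_sub; apply is_RInt_mul; apply RInt_of_ex; apply cell_integrable.
    - apply (Hcont cos). intros v; auto_derive; exact I.
    - apply (Hcont sin). intros v; auto_derive; exact I. }
  cbv beta.
  match goal with |- ?l = ?r => transitivity (P (N + 1) - P N) end.
  - rewrite <- E1, E2. ring.
  (* At the ends of the cell the weight is 0 and its derivative is 1 and -1, which leaves a sum of
     the two end values. *)
  - unfold P. field. lra.
Qed.

Lemma power_cell_dominated (f : R -> R) (t y phi : R) : -1 < t ->
  (forall v, ex_derive f v) -> (forall v, Rabs (f v) <= 1) ->
  cell_dominated (t + 1) 1 (fun v => exp (- (t + 2) * ln v) * f (y * ln v + phi)).
Proof.
  intros Ht Hf Hb. split; intros v Hv.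
  - apply continuous_of_ex_derive. auto_derive. repeat split; auto; lra.
  - rewrite Rabs_mult, (Rabs_pos_eq _ (Rlt_le _ _ (exp_pos _))), Rmult_1_l.
    replace (exp (- (t + 1) * ln v) / v) with (exp (- (t + 2) * ln v)).
    + rewrite <- (Rmult_1_r (exp _)) at 2. apply Rmult_le_compat_l. apply Rlt_le, exp_pos. apply Hb.
    + replace (- (t + 2) * ln v) with (- (t + 1) * ln v + - ln v) by ring.
      rewrite exp_plus, exp_Ropp, exp_ln by lra. reflexivity.
Qed.

Lemma Rabs_cos_le (v : R) : Rabs (cos v) <= 1.
Proof. apply Rabs_le, COS_bound. Qed.

Lemma Rabs_sin_le (v : R) : Rabs (sin v) <= 1.
Proof. apply Rabs_le, SIN_bound. Qed.

Lemma ex_derive_cos (v : R) : ex_derive cos v.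
Proof. auto_derive. exact I. Qed.

Lemma ex_derive_sin (v : R) : ex_derive sin v.
Proof. auto_derive. exact I. Qed.

(** Summed over the cells, the end values count every term of the series twice except the first, and
    the differences of v^(1-s) telescope to minus the value at v = 1, since v^(1-s) tends to 0 for
    Re s > 1. With Zc - i Zs for e^(-i phi) zeta(s), this is the real part of the identity for B(s)
    multiplied by e^(-i phi). *)
Lemma dirichlet_cell_identity (t y phi Zc Zs : R) : 1 < t ->
  is_series (fun n => exp (- t * ln (INR (S n))) * cos (y * ln (INR (S n)) + phi)) Zc ->
  is_series (fun n => exp (- t * ln (INR (S n))) * sin (y * ln (INR (S n)) + phi)) Zs ->
  (t - t ^ 3 + 3 * t * y ^ 2) * cell_sum (fun v => exp (- (t + 2) * ln v) * cos (y * ln v + phi))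
  + (y + y ^ 3 - 3 * t ^ 2 * y) * cell_sum (fun v => exp (- (t + 2) * ln v) * sin (y * ln v + phi))
  = 2 * ((1 - t) * Zc - y * Zs) - ((1 - t) * cos phi - y * sin phi) + 2 * cos phi.
Proof.
  intros Ht HZc HZs.
  set (al := t - t ^ 3 + 3 * t * y ^ 2). set (be := y + y ^ 3 - 3 * t ^ 2 * y).
  set (A := fun n => exp (- t * ln (INR (S n))) * ((1 - t) * cos (y * ln (INR (S n)) + phi) - y * sin (y * ln (INR (S n)) + phi))).
  set (D := fun n => INR (S n) * (exp (- t * ln (INR (S n))) * cos (y * ln (INR (S n)) + phi))).
  assert (HA : is_series A ((1 - t) * Zc - y * Zs)).
  { eapply is_series_ext_R; [| |apply is_series_minus_R;
      [apply is_series_mul_R, HZc|apply is_series_mul_R, HZs]]; [|reflexivity].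
    intros n. unfold A. cbv beta. ring. }
  assert (HD : is_lim_seq D 0).
  { apply is_lim_seq_abs_0.
    apply is_lim_seq_le_le with (fun _ => 0) (fun n => exp (- (t - 1) * ln (INR (S n)))).
    - intros n. split. apply Rabs_pos. unfold D.
      pose proof (lt_0_INR (S n) ltac:(lia)) as Hp.
      rewrite <- (exp_ln (INR (S n))) at 1 by assumption.
      rewrite <- Rmult_assoc, <- exp_plus, Rabs_mult, (Rabs_pos_eq _ (Rlt_le _ _ (exp_pos _))).
      replace (ln (INR (S n)) + - t * ln (INR (S n))) with (- (t - 1) * ln (INR (S n))) by ring.
      rewrite <- (Rmult_1_r (exp _)) at 2. apply Rmult_le_compat_l. apply Rlt_le, exp_pos. apply Rabs_cos_le.
    - apply is_lim_seq_const.
    - apply exp_ln_INR_0. lra. }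
  assert (HA0 : A 0%nat = (1 - t) * cos phi - y * sin phi).
  { unfold A. simpl INR. rewrite ln_1, !Rmult_0_r, exp_0, Rplus_0_l. ring. }
  assert (HD0 : D 0%nat = cos phi).
  { unfold D. simpl INR. rewrite ln_1, !Rmult_0_r, exp_0, Rplus_0_l. ring. }
  assert (HA1 := is_series_tail_R _ _ HA).
  pose proof (is_series_telescope D 0 HD) as HDs.
  assert (Hc := cell_sum_correct (t + 1) 1 _ ltac:(lra)
     (power_cell_dominated cos t y phi ltac:(lra) ex_derive_cos Rabs_cos_le)).
  assert (Hs := cell_sum_correct (t + 1) 1 _ ltac:(lra)
     (power_cell_dominated sin t y phi ltac:(lra) ex_derive_sin Rabs_sin_le)).
  assert (HL := is_series_plus_R _ _ _ _ (is_series_mul_R al _ _ Hc) (is_series_mul_R be _ _ Hs)).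
  assert (HR := is_series_minus_R _ _ _ _ (is_series_plus_R _ _ _ _ HA1 HA)
     (is_series_mul_R (- 2) _ _ HDs)).
  rewrite <- (is_series_unique _ _ HL).
  transitivity ((1 - t) * Zc - y * Zs - A 0%nat + ((1 - t) * Zc - y * Zs) - - 2 * (D 0%nat - 0)).
  - rewrite <- (is_series_unique _ _ HR). apply Series_ext. intros n.
    etransitivity. exact (cell_integral_by_parts t y phi n). unfold A, D. ring.
  - rewrite HA0, HD0. ring.
Qed.

(** * The value of zeta at 0 *)


(** At t = 0 the factor of the cosine sum vanishes and that of the sine sum is, up to sign, y + y^3,
    while the sine sum is at most 1 in absolute value (d = K = 1). The identity, known for t > 1,
    reaches t = 0 through [real_analytic_identity]. *)
Lemma strip_value_bound (y phi : R) (Zc Zs : R -> R) :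
  (forall t, -1 < t -> real_analytic_at Zc t) -> (forall t, -1 < t -> real_analytic_at Zs t) ->
  (forall t, 1 < t ->
    is_series (fun n => exp (- t * ln (INR (S n))) * cos (y * ln (INR (S n)) + phi)) (Zc t) /\
    is_series (fun n => exp (- t * ln (INR (S n))) * sin (y * ln (INR (S n)) + phi)) (Zs t)) ->
  Rabs (2 * (Zc 0 - y * Zs 0) + cos phi + y * sin phi) <= Rabs (y + y ^ 3).
Proof.
  intros HZc HZs Hser.
  set (U := fun t => cell_sum (fun v => exp (- (t + 2) * ln v) * cos (y * ln v + phi))).
  set (V := fun t => cell_sum (fun v => exp (- (t + 2) * ln v) * sin (y * ln v + phi))).
  (* Difference of the two sides of the identity, with polynomial factors padded to cubics to fit
     [real_analytic_mul_cubic]. *)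
  set (h := fun t => (2 + (- 2) * t + 0 * t ^ 2 + 0 * t ^ 3) * Zc t + (- (2 * y) * Zs t +
     ((cos phi + y * sin phi + cos phi * t + 0 * t ^ 2 + 0 * t ^ 3) * 1 +
      ((0 + - (1 + 3 * y ^ 2) * t + 0 * t ^ 2 + 1 * t ^ 3) * U t +
       (- (y + y ^ 3) + 0 * t + 3 * y * t ^ 2 + 0 * t ^ 3) * V t)))).
  assert (HU : forall t, -1 < t -> real_analytic_at U t).
  { intros t Ht. apply (cell_sum_power_analytic (fun v => cos (y * ln v + phi))); [| |assumption].
    - intros v Hv. apply continuous_of_ex_derive. auto_derive. lra.
    - intros v. apply Rabs_cos_le. }
  assert (HV : forall t, -1 < t -> real_analytic_at V t).
  { intros t Ht. apply (cell_sum_power_analytic (fun v => sin (y * ln v + phi))); [| |assumption].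
    - intros v Hv. apply continuous_of_ex_derive. auto_derive. lra.
    - intros v. apply Rabs_sin_le. }
  assert (Hh : h 0 = 0).
  { apply (real_analytic_identity h (-1) 1); [| |lra].
    - intros t Ht. unfold h.
      repeat apply real_analytic_plus; try apply real_analytic_scal; try apply real_analytic_mul_cubic; auto.
      apply real_analytic_const.
    - intros t Ht. destruct (Hser t Ht) as [H1 H2].
      pose proof (dirichlet_cell_identity t y phi _ _ Ht H1 H2) as E. fold (U t) (V t) in E.
      unfold h. lra. }
  replace (2 * (Zc 0 - y * Zs 0) + cos phi + y * sin phi) with ((y + y ^ 3) * V 0).
  - rewrite Rabs_mult. rewrite <- Rmult_1_r. apply Rmult_le_compat_l. apply Rabs_pos.
    pose proof (cell_sum_bound (0 + 1) 1 _ ltac:(lra)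
      (power_cell_dominated sin 0 y phi ltac:(lra) ex_derive_sin Rabs_sin_le)) as H.
    unfold V. lra.
  - unfold h in Hh. lra.
Qed.

(** The minus sign comes from n^(-iy) = cos (y ln n) - i sin (y ln n). *)
Lemma zeta_series_parts (zeta : C -> C) (t y : R) : is_riemann_zeta zeta -> 1 < t ->
  is_series (fun n => exp (- t * ln (INR (S n))) * cos (y * ln (INR (S n)))) (fst (zeta (t, y))) /\
  is_series (fun n => exp (- t * ln (INR (S n))) * sin (y * ln (INR (S n)))) (- snd (zeta (t, y))).
Proof.
  intros [Hz _] Ht. destruct (proj1 (is_series_C_iff _ _) (Hz (t, y) Ht)) as [H1 H2].
  assert (Eim : forall L : R, - t * 0 + - y * L = - (y * L)) by (intros; ring).
  assert (Ere : forall L : R, - t * L - - y * 0 = - t * L) by (intros; ring).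
  split.
  - eapply is_series_ext_R; [|reflexivity|exact H1]. intros n.
    unfold nat_Cpow, Cexp, Cmult, Copp, RtoC, Re, Im. cbn [fst snd].
    rewrite Eim, Ere, cos_neg. reflexivity.
  - eapply is_series_ext_R; [| |apply (is_series_mul_R (- 1)), H2].
    + intros n. unfold nat_Cpow, Cexp, Cmult, Copp, RtoC, Re, Im. cbn [fst snd].
      rewrite Eim, Ere, sin_neg. ring.
    + ring.
Qed.

Lemma real_analytic_shift (h : R -> R) (t0 : R) :
  real_analytic_at (fun u => h (t0 + u)) 0 -> real_analytic_at h t0.
Proof.
  intros (a & r & Hr & H). exists a, r. split; [assumption|].
  intros u Hu. specialize (H u Hu). now rewrite Rplus_0_l in H.
Qed.

Lemma zeta_horizontal_analytic (zeta : C -> C) (t y : R) : is_riemann_zeta zeta -> y <> 0 ->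
  real_analytic_at (fun t => fst (zeta (t, y))) t /\ real_analytic_at (fun t => snd (zeta (t, y))) t.
Proof.
  intros [_ Ha] Hy.
  destruct (analytic_at_along_line zeta (t, y) (RtoC 1)) as [H1 H2].
  - simpl. rewrite Rabs_R1; lra.
  - simpl. rewrite Rabs_R0; lra.
  - apply Ha. intros E. apply Hy. now injection E.
  - assert (E : forall u, Cplus (t, y) (Cmult (RtoC u) (RtoC 1)) = (t + u, y)).
    { intros u. unfold Cplus, Cmult, RtoC. simpl. f_equal; ring. }
    split; apply real_analytic_shift; [revert H1|revert H2]; apply real_analytic_ext; intros u; now rewrite E.
Qed.

(** The vertical line through 0 avoids the pole, so continuity along it recovers the value at 0,
    which lies on none of the horizontal lines y <> 0. *)
Lemma zeta_vertical_continuous (zeta : C -> C) : is_riemann_zeta zeta ->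
  continuous (fun y => fst (zeta (0, y))) 0 /\ continuous (fun y => snd (zeta (0, y))) 0.
Proof.
  intros [_ Ha].
  destruct (analytic_at_along_line zeta (RtoC 0) Ci) as [H1 H2].
  - simpl. rewrite Rabs_R0; lra.
  - simpl. rewrite Rabs_R1; lra.
  - apply Ha. intros E. apply R1_neq_R0. symmetry. now injection E.
  - assert (E : forall u, Cplus (RtoC 0) (Cmult (RtoC u) Ci) = (0, u)).
    { intros u. unfold Cplus, Cmult, RtoC, Ci. simpl. f_equal; ring. }
    split; apply real_analytic_continuous; [revert H1|revert H2]; apply real_analytic_ext; intros u; now rewrite E.
Qed.

Lemma zero_of_continuous_bound (k : R -> R) :
  continuous k 0 -> (forall y, y <> 0 -> Rabs (k y) <= Rabs (y + y ^ 3)) -> k 0 = 0.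
Proof.
  intros Hk Hb. set (y := fun n => / INR (S n)).
  assert (Hy : is_lim_seq y 0).
  { unfold y. replace (Finite 0) with (Rbar_inv p_infty) by reflexivity.
    apply is_lim_seq_inv; [|discriminate]. apply (is_lim_seq_incr_1 INR), is_lim_seq_INR. }
  assert (H1 : is_lim_seq (fun n => k (y n)) (k 0)).
  { apply is_lim_seq_continuous; [|assumption]. now apply continuity_pt_filterlim. }
  assert (H2 : is_lim_seq (fun n => k (y n)) 0).
  { apply is_lim_seq_abs_0.
    apply is_lim_seq_le_le with (fun _ => 0) (fun n => Rabs (y n + y n ^ 3)).
    - intros n. split. apply Rabs_pos. apply Hb. apply Rinv_neq_0_compat. apply not_0_INR; lia.
    - apply is_lim_seq_const.
    - assert (E0 : Rabs (0 + 0 ^ 3) = 0) by (replace (0 + 0 ^ 3) with 0 by ring; apply Rabs_R0).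
      replace (Finite 0) with (Finite (Rabs (0 + 0 ^ 3))) by now rewrite E0.
      apply (is_lim_seq_continuous (fun y => Rabs (y + y ^ 3))); [|assumption].
      apply continuity_pt_filterlim.
      apply (continuous_comp (fun y => y + y ^ 3) Rabs); [|apply continuous_Rabs].
      apply continuous_of_ex_derive. auto_derive. exact I. }
  apply is_lim_seq_unique in H1. apply is_lim_seq_unique in H2. rewrite H1 in H2. now injection H2.
Qed.

Lemma zeta_at_0 (zeta : C -> C) : is_riemann_zeta zeta -> zeta (RtoC 0) = RtoC (- (1 / 2)).
Proof.
  intros Hz. destruct (zeta_vertical_continuous zeta Hz) as [Cf Cg].
  set (f := fun y => fst (zeta (0, y))) in *. set (g := fun y => snd (zeta (0, y))) in *.
  assert (Hlin : forall (p q : R -> R) (c d e : R), continuous p 0 -> continuous q 0 ->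
     continuous (fun y => 2 * (p y + e * (y * q y)) + c + d * y) 0).
  { intros p q c d e Hp Hq.
    assert (continuous (fun y => 2 * (p y + e * (y * q y))) 0).
    { apply (continuous_mult (K := R_AbsRing) (fun _ => 2)). apply continuous_const.
      apply (continuous_plus (V := R_NormedModule)). assumption.
      apply (continuous_mult (K := R_AbsRing) (fun _ => e)). apply continuous_const.
      apply (continuous_mult (K := R_AbsRing) (fun y => y)). apply continuous_id. assumption. }
    apply (continuous_plus (V := R_NormedModule) (fun y => 2 * (p y + e * (y * q y)) + c)).
    apply (continuous_plus (V := R_NormedModule) (fun y => 2 * (p y + e * (y * q y)))). assumption.
    apply continuous_const. apply continuous_of_ex_derive. auto_derive. exact I. }
  (* Phase 0: the limit y -> 0 gives 2 Re zeta(0) + 1 = 0. *)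
  assert (E1 : 2 * (f 0 + 1 * (0 * g 0)) + 1 + 0 * 0 = 0).
  { apply (zero_of_continuous_bound (fun y => 2 * (f y + 1 * (y * g y)) + 1 + 0 * y)).
    now apply Hlin. intros y Hy.
    pose proof (strip_value_bound y 0 (fun t => fst (zeta (t, y))) (fun t => - 1 * snd (zeta (t, y)))) as H.
    cbv beta in H. rewrite cos_0, sin_0 in H. fold (f y) (g y) in H.
    replace (2 * (f y + 1 * (y * g y)) + 1 + 0 * y) with (2 * (f y - y * (- 1 * g y)) + 1 + y * 0) by ring.
    apply H.
    - intros t _. now apply zeta_horizontal_analytic.
    - intros t _. apply real_analytic_scal. now apply zeta_horizontal_analytic.
    - intros t Ht. destruct (zeta_series_parts zeta t y Hz Ht) as [S1 S2]. split.
      + eapply is_series_ext_R; [|reflexivity|exact S1]. intros n; now rewrite Rplus_0_r.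
      + eapply is_series_ext_R; [| |exact S2]. intros n; now rewrite Rplus_0_r. ring. }
  (* Phase pi/2: multiplication by -i brings Im zeta to the real part, and the limit gives Im
     zeta(0) = 0. *)
  assert (E2 : 2 * (g 0 + - 1 * (0 * f 0)) + 0 + 1 * 0 = 0).
  { apply (zero_of_continuous_bound (fun y => 2 * (g y + - 1 * (y * f y)) + 0 + 1 * y)).
    now apply Hlin. intros y Hy.
    pose proof (strip_value_bound y (PI / 2) (fun t => snd (zeta (t, y))) (fun t => fst (zeta (t, y)))) as H.
    cbv beta in H. rewrite cos_PI2, sin_PI2 in H. fold (f y) (g y) in H.
    replace (2 * (g y + - 1 * (y * f y)) + 0 + 1 * y) with (2 * (g y - y * f y) + 0 + y * 1) by ring.
    apply H.
    - intros t _. now apply zeta_horizontal_analytic.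
    - intros t _. now apply zeta_horizontal_analytic.
    - intros t Ht. destruct (zeta_series_parts zeta t y Hz Ht) as [S1 S2].
      assert (Ec : forall x, cos (x + PI / 2) = - sin x)
        by (intros; rewrite cos_plus, cos_PI2, sin_PI2; ring).
      assert (Es : forall x, sin (x + PI / 2) = cos x)
        by (intros; rewrite sin_plus, cos_PI2, sin_PI2; ring).
      split.
      + eapply is_series_ext_R; [| |apply (is_series_mul_R (- 1)), S2].
        intros n; rewrite Ec; ring. ring.
      + eapply is_series_ext_R; [|reflexivity|exact S1]. intros n; now rewrite Es. }
  unfold RtoC. rewrite (surjective_pairing (zeta (0, 0))). fold (f 0) (g 0). f_equal; lra.
Qed.

(** * Power series of ln (pi x / sin (pi x)) *)


(** Tonelli for double series. Finitely many columns sum to at most S, so the columns have a total T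
    <= S; finitely many rows are compared with T in the same way, whence S <= T. *)
Lemma is_series_swap_nonneg (a : nat -> nat -> R) (rows cols : nat -> R) (S : R) :
  (forall n k, 0 <= a n k) -> (forall n, is_series (a n) (rows n)) ->
  (forall k, is_series (fun n => a n k) (cols k)) -> is_series rows S -> is_series cols S.
Proof.
  intros Ha Hr Hc HS.
  assert (Hle : forall b l, (forall n, 0 <= b n) -> is_series b l -> forall N, sum_n b N <= l).
  { intros b l Hb Hl N. apply (is_lim_seq_incr_compare (sum_n b)); [exact Hl|].
    intros n. rewrite sum_n_S. specialize (Hb (Datatypes.S n)). lra. }
  assert (Hfin : forall (u : nat -> nat -> R) (v : nat -> R) K, (forall k, is_series (u k) (v k)) ->
     is_series (fun n => sum_n (fun k => u k n) K) (sum_n v K)).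
  { intros u v K Hu. induction K as [|K IH].
    - rewrite sum_O. eapply is_series_ext_R; [|reflexivity|exact (Hu 0%nat)].
      intros n. now rewrite sum_O.
    - rewrite sum_n_S. eapply is_series_ext_R; [|reflexivity|exact (is_series_plus_R _ _ _ _ IH (Hu (Datatypes.S K)))].
      intros n. now rewrite sum_n_S. }
  assert (Hnn : forall b, (forall n, 0 <= b n) -> forall l, is_series b l -> 0 <= l).
  { intros b Hb l Hl. apply Rle_trans with (b 0%nat). apply Hb.
    rewrite <- (sum_O b). now apply Hle. }
  assert (Hcols0 : forall k, 0 <= cols k) by (intros k; apply (Hnn _ (fun n => Ha n k) _ (Hc k))).
  assert (Hrows0 : forall n, 0 <= rows n) by (intros n; apply (Hnn _ (Ha n) _ (Hr n))).
  assert (Hup : forall K, sum_n cols K <= S).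
  { intros K. apply (is_lim_seq_le (fun N => sum_n (fun n => sum_n (fun k => a n k) K) N) (sum_n rows) (sum_n cols K) S).
    - intros N. rewrite !sum_n_Reals. apply sum_Rle. intros n _. apply Hle; [apply Ha|apply Hr].
    - exact (Hfin (fun k n => a n k) cols K Hc).
    - exact HS. }
  destruct (ex_finite_lim_seq_incr (sum_n cols) S) as [T HT].
  - intros n. rewrite sum_n_S. specialize (Hcols0 (Datatypes.S n)). lra.
  - exact Hup.
  - replace S with T; [exact HT|]. apply Rle_antisym.
    + apply (is_lim_seq_le (sum_n cols) (fun _ => S) T S Hup HT). apply is_lim_seq_const.
    + apply (is_lim_seq_le (sum_n rows) (fun _ => T) S T); [|exact HS|apply is_lim_seq_const].
      intros N. apply (is_lim_seq_le (fun K => sum_n (fun k => sum_n (fun n => a n k) N) K) (sum_n cols) (sum_n rows N) T).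
      * intros K. rewrite !sum_n_Reals. apply sum_Rle. intros k _.
        apply (Hle (fun n => a n k)); [intros n; apply Ha|apply Hc].
      * exact (Hfin a rows N Hr).
      * exact HT.
Qed.

Lemma is_series_log (v : R) : 0 <= v < 1 ->
  is_series (fun k => v ^ (S k) / INR (S k)) (- ln (1 - v)).
Proof.
  intros Hv.
  assert (Hgeo : forall t, Rabs t < 1 -> is_pseries (fun _ => 1) t (/ (1 - t))).
  { intros t Ht. apply is_pseries_R. eapply is_series_ext_R; [|reflexivity|exact (is_series_geom t Ht)].
    intros n; cbv beta. ring. }
  assert (Hrad : forall t, Rabs t < 1 -> Rbar_lt (Rabs t) (CV_radius (fun _ => 1))).
  { intros t Ht. apply ex_pseries_radius_lt with 1; [|assumption].
    intros u Hu. eexists. apply Hgeo. rewrite Rabs_pos_eq; lra. }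
  assert (Hv1 : Rabs v < 1) by (rewrite Rabs_pos_eq; lra).
  pose proof (is_pseries_RInt _ _ (Hrad v Hv1)) as H.
  replace (RInt (PSeries (fun _ => 1)) 0 v) with (- ln (1 - v)) in H.
  - apply is_pseries_R in H.
    eapply is_series_ext_R; [| |exact (is_series_tail_R _ _ H)].
    + intros n. unfold PS_Int. cbv beta. unfold Rdiv. ring.
    + unfold PS_Int. ring.
  - symmetry. rewrite (RInt_ext _ (fun t => / (1 - t))).
    + rewrite (RInt_FTC (fun t => - ln (1 - t))).
      * rewrite Rminus_0_r, ln_1. eq_R. ring.
      * intros t Ht. rewrite Rmin_left, Rmax_right in Ht by lra. auto_derive. lra. field. lra.
      * intros t Ht. rewrite Rmin_left, Rmax_right in Ht by lra.
        apply continuous_of_ex_derive. auto_derive. lra.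
    + intros t Ht. rewrite Rmin_left, Rmax_right in Ht by lra.
      apply is_pseries_unique, Hgeo. rewrite Rabs_pos_eq; lra.
Qed.

(** [z 0] is left free: the logarithm of the sine product involves zeta(2k) for k >= 1 only, and
    zeta(0) is not the sum of a Dirichlet series. *)
Definition even_zeta_values (z : nat -> R) : Prop :=
  forall k, is_series (fun n => / INR (S n) ^ (2 * S k)) (z (S k)).

(** Each logarithm in the sine product is expanded in powers of x^2 / n^2; all terms are
    nonnegative, so the sum over n may be taken first. *)
Lemma log_sine_zeta_series (z : nat -> R) (x : R) : even_zeta_values z -> 0 < x < 1 ->
  is_series (fun k => z (S k) / INR (S k) * x ^ (2 * S k)) (ln (PI * x / sin (PI * x))).
Proof.
  intros Hz Hx.
  assert (Hn : forall n, 1 <= INR (S n)) by (intros n; rewrite S_INR; pose proof (pos_INR n); lra).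
  assert (Hv : forall n, 0 <= x ^ 2 / INR (S n) ^ 2 < 1).
  { intros n. specialize (Hn n). split. apply Rdiv_le_0_compat; nra.
    apply Rlt_div_l; nra. }
  apply (is_series_swap_nonneg (fun n k => (x ^ 2 / INR (S n) ^ 2) ^ (S k) / INR (S k))
    (fun n => - ln (1 - x ^ 2 / INR (S n) ^ 2))).
  - intros n k. apply Rdiv_le_0_compat. apply pow_le, Hv. specialize (Hn k). lra.
  - intros n. apply is_series_log, Hv.
  - intros k. eapply is_series_ext_R; [| |exact (is_series_mul_R (x ^ (2 * S k) / INR (S k)) _ _ (Hz k))].
    + intros n. cbv beta. specialize (Hn n). rewrite !pow_mult. unfold Rdiv. rewrite Rpow_mult_distr, pow_inv. ring.
    + unfold Rdiv. ring.
  - now apply log_sine_product.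
Qed.

(* Taylor coefficients at 0 of [ln (PI * x / sin (PI * x))] when [z k = zeta (2 k)]. *)
Definition log_sine_coef (z : nat -> R) (j : nat) : R :=
  if Nat.even j then match Nat.div2 j with O => 0 | S k => z (S k) / INR (S k) end else 0.

Lemma log_sine_coef_even (z : nat -> R) (n : nat) :
  log_sine_coef z (2 * n) = match n with O => 0 | S k => z (S k) / INR (S k) end.
Proof.
  unfold log_sine_coef. rewrite Nat.even_even, Nat.div2_double. reflexivity.
Qed.

Lemma log_sine_coef_odd (z : nat -> R) (n : nat) : log_sine_coef z (2 * n + 1) = 0.
Proof. unfold log_sine_coef. now rewrite Nat.even_odd. Qed.

Lemma log_sine_even_series (z : nat -> R) (x : R) : even_zeta_values z -> 0 < x < 1 ->
  is_series (fun n => log_sine_coef z (2 * n) * x ^ (2 * n)) (ln (PI * x / sin (PI * x))).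
Proof.
  intros Hz Hx. apply (is_series_decr_1 (K := R_AbsRing) (V := R_NormedModule)).
  eapply is_series_ext_R; [| |exact (log_sine_zeta_series z x Hz Hx)].
  - intros n. now rewrite log_sine_coef_even.
  - rewrite log_sine_coef_even. unfold plus, opp; simpl. ring.
Qed.

Lemma log_sine_pseries (z : nat -> R) (x : R) : even_zeta_values z -> 0 < x < 1 ->
  is_pseries (log_sine_coef z) x (ln (PI * x / sin (PI * x))).
Proof.
  intros Hz Hx. rewrite <- (Rplus_0_r (ln _)), <- (Rmult_0_r x).
  apply is_pseries_odd_even.
  - apply is_pseries_R. eapply is_series_ext_R; [| |exact (log_sine_even_series z x Hz Hx)]; [|reflexivity].
    intros n. cbv beta. now rewrite <- pow_mult.
  - apply is_pseries_R. eapply is_series_ext_R; [| |exact (is_series_mul_R 0 _ _ (is_series_geom 0 ltac:(rewrite Rabs_R0; lra)))].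
    intros n. rewrite log_sine_coef_odd. ring. ring.
Qed.

Lemma log_sine_radius (z : nat -> R) (x : R) : even_zeta_values z -> Rabs x < 1 ->
  Rbar_lt (Rabs x) (CV_radius (log_sine_coef z)).
Proof.
  intros Hz Hx. apply ex_pseries_radius_lt with 1; [|assumption].
  intros u Hu. eexists. now apply log_sine_pseries.
Qed.

Lemma is_derive_PS_Int (a : nat -> R) (x : R) : Rbar_lt (Rabs x) (CV_radius a) ->
  is_derive (PSeries (PS_Int a)) x (PSeries a x).
Proof.
  intros Hx. rewrite <- (PSeries_ext (PS_derive (PS_Int a)) a).
  - apply is_derive_PSeries. now rewrite CV_radius_Int.
  - intros n. unfold PS_derive, PS_Int. field. apply not_0_INR; lia.
Qed.

(* The second primitive of [ln (2 * sin (PI * x))] that is o(x) at 0. *)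
Definition clausen_primitive (z : nat -> R) (x : R) : R :=
  x ^ 2 / 2 * ln (2 * PI * x) - 3 / 4 * x ^ 2 - PSeries (PS_Int (PS_Int (log_sine_coef z))) x.

(** In ln (2 sin (pi x)) = ln (2 pi x) - ln (pi x / sin (pi x)) the singular part is integrated in
    closed form, twice for [clausen_primitive] (hence its 3/4), and the analytic part through its
    power series. *)
Definition clausen_primitive_derivative (z : nat -> R) (x : R) : R :=
  x * ln (2 * PI * x) - x - PSeries (PS_Int (log_sine_coef z)) x.

Lemma is_derive_clausen_primitive (z : nat -> R) (x : R) : even_zeta_values z -> 0 < x < 1 ->
  is_derive (clausen_primitive z) x (clausen_primitive_derivative z x).
Proof.
  intros Hz Hx. pose proof PI_RGT_0 as HPI. unfold clausen_primitive, clausen_primitive_derivative.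
  apply (is_derive_minus (K := R_AbsRing) (V := R_NormedModule)
    (fun x => x ^ 2 / 2 * ln (2 * PI * x) - 3 / 4 * x ^ 2)).
  - auto_derive. apply Rmult_lt_0_compat; lra. field. lra.
  - apply is_derive_PS_Int. rewrite CV_radius_Int. apply log_sine_radius; [assumption|].
    rewrite Rabs_pos_eq; lra.
Qed.

Lemma is_derive_clausen_primitive_derivative (z : nat -> R) (x : R) : even_zeta_values z -> 0 < x < 1 ->
  is_derive (clausen_primitive_derivative z) x (ln (2 * sin (PI * x))).
Proof.
  intros Hz Hx. pose proof PI_RGT_0 as HPI. unfold clausen_primitive_derivative.
  assert (Hpx : 0 < PI * x) by (apply Rmult_lt_0_compat; lra).
  assert (Hs : 0 < sin (PI * x)) by (apply sin_gt_0; nra).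
  assert (E : ln (2 * sin (PI * x)) = ln (2 * PI * x) - PSeries (log_sine_coef z) x).
  { rewrite (is_pseries_unique _ _ _ (log_sine_pseries z x Hz Hx)).
    rewrite ln_div, !ln_mult by lra. ring. }
  rewrite E.
  apply (is_derive_minus (K := R_AbsRing) (V := R_NormedModule) (fun x => x * ln (2 * PI * x) - x)).
  - auto_derive. lra. field. lra.
  - apply is_derive_PS_Int. apply log_sine_radius; [assumption|].
    rewrite Rabs_pos_eq; lra.
Qed.

(** * Fourier series of ln (2 sin (pi x)) *)


(** Only finite sums are differentiated; the exponent [p] keeps the derivatives within this family
    and that of [sin_sum]. *)
Definition cos_sum (p N : nat) (x : R) : R :=
  sum_n (fun n => cos (2 * PI * INR (S n) * x) / INR (S n) ^ p) N.

Definition sin_sum (p N : nat) (x : R) : R :=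
  sum_n (fun n => sin (2 * PI * INR (S n) * x) / INR (S n) ^ p) N.

Lemma is_derive_cos_sum (p N : nat) (x : R) :
  is_derive (cos_sum (S p) N) x (- (2 * PI) * sin_sum p N x).
Proof.
  unfold cos_sum, sin_sum.
  rewrite sum_n_mul_R.
  apply (is_derive_sum_n (K := R_AbsRing) (V := R_NormedModule)
    (fun n x => cos (2 * PI * INR (S n) * x) / INR (S n) ^ (S p)) N x).
  intros k _. pose proof (lt_0_INR (S k) ltac:(lia)) as Hk. set (K := INR (S k)) in *.
  pose proof (pow_lt K p Hk). cbn [pow]. auto_derive. nra. field. lra.
Qed.

Lemma is_derive_sin_sum (p N : nat) (x : R) :
  is_derive (sin_sum (S p) N) x (2 * PI * cos_sum p N x).
Proof.
  unfold cos_sum, sin_sum.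
  rewrite sum_n_mul_R.
  apply (is_derive_sum_n (K := R_AbsRing) (V := R_NormedModule)
    (fun n x => sin (2 * PI * INR (S n) * x) / INR (S n) ^ (S p)) N x).
  intros k _. pose proof (lt_0_INR (S k) ltac:(lia)) as Hk. set (K := INR (S k)) in *.
  pose proof (pow_lt K p Hk). cbn [pow]. auto_derive. nra. field. lra.
Qed.

(** The product formula makes the sum telescope. There are N + 1 terms, whence 2N + 3. *)
Lemma dirichlet_kernel (N : nat) (x : R) :
  2 * sin (PI * x) * sin_sum 0 N x = cos (PI * x) - cos ((2 * INR N + 3) * PI * x).
Proof.
  assert (Hprod : forall A B, 2 * sin B * sin A = cos (A - B) - cos (A + B)).
  { intros A B. rewrite cos_minus, cos_plus. ring. }
  unfold sin_sum. induction N as [|N IH].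
  - rewrite sum_O. simpl INR. replace (sin (2 * PI * 1 * x) / 1 ^ 0) with (sin (2 * PI * x)).
    rewrite Hprod. f_equal; f_equal; ring. simpl. rewrite Rmult_1_r. field.
  - rewrite sum_n_S, Rmult_plus_distr_l, IH.
    replace (sin (2 * PI * INR (S (S N)) * x) / INR (S (S N)) ^ 0) with (sin (2 * PI * INR (S (S N)) * x))
      by (cbn [pow]; field).
    rewrite Hprod. rewrite !S_INR.
    replace (2 * PI * (INR N + 1 + 1) * x - PI * x) with ((2 * INR N + 3) * PI * x) by ring.
    replace (2 * PI * (INR N + 1 + 1) * x + PI * x) with ((2 * (INR N + 1) + 3) * PI * x) by ring.
    ring.
Qed.

Lemma derive_bound_le (f df : R -> R) (a b M : R) :
  a <= b -> (forall x, a <= x <= b -> is_derive f x (df x)) ->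
  (forall x, a <= x <= b -> Rabs (df x) <= M) -> Rabs (f b - f a) <= M * (b - a).
Proof.
  intros Hab Hd Hp.
  destruct (MVT_gen f a b df) as [c [Hc E]].
  - rewrite Rmin_left, Rmax_right by lra. intros x Hx. apply Hd; lra.
  - rewrite Rmin_left, Rmax_right by lra. intros x Hx.
    apply continuity_pt_filterlim. apply continuous_of_ex_derive. eexists; apply Hd; lra.
  - rewrite Rmin_left, Rmax_right in Hc by lra. rewrite E, Rabs_mult, (Rabs_pos_eq (b - a)) by lra.
    apply Rmult_le_compat_r; [lra|]. now apply Hp.
Qed.

(** The error in the series of ln (1 + x) has derivative (-x)^(N+1) / (1 + x), at most x^(N+1) in
    absolute value on [0, 1]; comparison with x^(N+2) / (N+2) gives the bound at x = 1. It fixes the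
    Fourier series at the base point 1/2. *)
Lemma ln_2_alternating (N : nat) :
  Rabs (ln 2 - sum_n (fun n => (-1) ^ n / INR (S n)) N) <= / INR (S (S N)).
Proof.
  set (f := fun x => ln (1 + x) - sum_n (fun n => (-1) ^ n * x ^ (S n) / INR (S n)) N).
  assert (Hf : forall x, 0 <= x <= 1 -> is_derive f x ((- x) ^ (S N) / (1 + x))).
  { intros x Hx. replace ((- x) ^ (S N) / (1 + x)) with (/ (1 + x) - sum_n (fun n => (- x) ^ n) N).
    - apply (is_derive_minus (K := R_AbsRing) (V := R_NormedModule) (fun x => ln (1 + x))).
      + auto_derive. lra. field. lra.
      + apply (is_derive_sum_n (K := R_AbsRing) (V := R_NormedModule)
          (fun n x => (-1) ^ n * x ^ (S n) / INR (S n)) N x).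
        intros k _. pose proof (lt_0_INR (S k) ltac:(lia)) as Hk.
        apply is_derive_ext with (fun x => (-1) ^ k / INR (S k) * x ^ (S k)).
        intros t. unfold Rdiv. eq_R. ring.
        replace ((- x) ^ k) with ((-1) ^ k / INR (S k) * (INR (S k) * 1 * x ^ k)).
        apply is_derive_scal. apply (is_derive_pow (fun x => x) (S k) x 1). apply (is_derive_id (K := R_AbsRing)).
        replace (- x) with (-1 * x) by ring. rewrite Rpow_mult_distr. field. lra.
    - rewrite sum_n_Reals, tech3 by lra. unfold Rminus. rewrite Ropp_involutive. field. lra. }
  assert (Habs : forall x, 0 <= x <= 1 -> Rabs ((- x) ^ (S N) / (1 + x)) <= x ^ (S N)).
  { intros x Hx. unfold Rdiv. rewrite Rabs_mult, <- RPow_abs, Rabs_Ropp, (Rabs_pos_eq x) by lra.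
    rewrite Rabs_inv, (Rabs_pos_eq (1 + x)) by lra.
    rewrite <- (Rmult_1_r (x ^ S N)) at 2. apply Rmult_le_compat_l. apply pow_le; lra.
    rewrite <- Rinv_1. apply Rinv_le_contravar; lra. }
  pose proof (lt_0_INR (S (S N)) ltac:(lia)) as HN.
  set (g := fun x => x ^ (S (S N)) / INR (S (S N))).
  assert (Hg : forall x, is_derive g x (x ^ (S N))).
  { intros x. unfold g. apply is_derive_ext with (fun x => / INR (S (S N)) * x ^ (S (S N))).
    intros t. unfold Rdiv. eq_R. ring.
    replace (x ^ S N) with (/ INR (S (S N)) * (INR (S (S N)) * 1 * x ^ (S N))) by (field; lra).
    apply is_derive_scal. apply (is_derive_pow (fun x => x) (S (S N)) x 1). apply (is_derive_id (K := R_AbsRing)). }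
  assert (Hf0 : f 0 = 0).
  { unfold f. rewrite Rplus_0_r, ln_1. rewrite (sum_n_ext _ (fun _ => 0)).
    rewrite sum_n_const. ring. intros n. eq_R. simpl. unfold Rdiv. ring. }
  assert (Hg0 : g 0 = 0) by (unfold g; cbn [pow]; unfold Rdiv; ring).
  assert (Hf1 : f 1 = ln 2 - sum_n (fun n => (-1) ^ n / INR (S n)) N).
  { unfold f. replace (1 + 1) with 2 by ring. f_equal. apply sum_n_ext. intros n. now rewrite pow1, Rmult_1_r. }
  assert (Hg1 : g 1 = / INR (S (S N))) by (unfold g; rewrite pow1; field; lra).
  rewrite <- Hf1, <- Hg1. apply Rabs_le. split.
  - assert (g 0 + f 0 <= g 1 + f 1); [|lra].
    apply (nonneg_derive_le (fun x => g x + f x) (fun x => x ^ (S N) + (- x) ^ (S N) / (1 + x))); [lra| |].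
    + intros x Hx. apply (is_derive_plus (K := R_AbsRing) (V := R_NormedModule)). apply Hg. now apply Hf.
    + intros x Hx. specialize (Habs x Hx). apply Rabs_le_between in Habs. lra.
  - assert (g 0 - f 0 <= g 1 - f 1); [|lra].
    apply (nonneg_derive_le (fun x => g x - f x) (fun x => x ^ (S N) - (- x) ^ (S N) / (1 + x))); [lra| |].
    + intros x Hx. apply (is_derive_minus (K := R_AbsRing) (V := R_NormedModule)). apply Hg. now apply Hf.
    + intros x Hx. specialize (Habs x Hx). apply Rabs_le_between in Habs. lra.
Qed.

Lemma cos_sum_half (N : nat) :
  cos_sum 1 N (1 / 2) = - sum_n (fun n => (-1) ^ n / INR (S n)) N.
Proof.
  assert (Hc : forall n, cos (2 * PI * INR (S n) * (1 / 2)) = (-1) ^ (S n)).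
  { intros n. replace (2 * PI * INR (S n) * (1 / 2)) with (INR (S n) * PI) by field.
    generalize (S n). clear n. intros n. induction n as [|n IH].
    - simpl. rewrite Rmult_0_l, cos_0. ring.
    - rewrite S_INR, Rmult_plus_distr_r, Rmult_1_l, neg_cos, IH. simpl; ring. }
  unfold cos_sum. induction N as [|N IH].
  - rewrite !sum_O, Hc. simpl. field.
  - rewrite !sum_n_S, IH, Hc. rewrite pow_1. cbn [pow]. pose proof (lt_0_INR (S (S N)) ltac:(lia)). field. lra.
Qed.

Lemma sin_sum_half (p N : nat) : sin_sum p N (1 / 2) = 0.
Proof.
  assert (Hs : forall n, sin (2 * PI * INR (S n) * (1 / 2)) = 0).
  { intros n. replace (2 * PI * INR (S n) * (1 / 2)) with (INR (S n) * PI) by field.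
    generalize (S n). clear n. intros n. induction n as [|n IH].
    - simpl. now rewrite Rmult_0_l, sin_0.
    - rewrite S_INR, Rmult_plus_distr_r, Rmult_1_l, neg_sin, IH. ring. }
  unfold sin_sum. rewrite (sum_n_ext _ (fun _ => 0)).
  - rewrite sum_n_const. ring.
  - intros n. rewrite Hs. eq_R. unfold Rdiv. ring.
Qed.

(* The derivative of the remainder is [PI cos ((2N+3) PI x) / sin (PI x)]; subtracting
   [sin ((2N+3) PI x) / ((2N+3) sin (PI x))] makes it of size [1/N], as in the Riemann-Lebesgue lemma. *)
Lemma log_sine_fourier_bound (a x : R) (N : nat) : 0 < a -> a <= x <= 1 / 2 ->
  Rabs (ln (2 * sin (PI * x)) + cos_sum 1 N x) <=
    / INR (S (S N)) + (1 / sin (PI * a) + 1 + PI / sin (PI * a) ^ 2) / INR (S N).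
Proof.
  intros Ha Hx. pose proof PI_RGT_0 as HPI.
  set (s := sin (PI * a)).
  assert (Hs : 0 < s) by (apply sin_gt_0; nra).
  assert (Hmono : forall v, a <= v <= 1 / 2 -> s <= sin (PI * v)).
  { intros v Hv. unfold s. destruct (Req_dec a v) as [->|]. lra.
    apply Rlt_le, sin_increasing_1; nra. }
  set (M := 2 * INR N + 3). assert (HM : INR (S N) <= M) by (unfold M; rewrite S_INR; pose proof (pos_INR N); lra).
  pose proof (lt_0_INR (S N) ltac:(lia)) as HN.
  set (Q := fun v => ln (2 * sin (PI * v)) + cos_sum 1 N v - sin (M * PI * v) / (M * sin (PI * v))).
  assert (HQ : forall v, a <= v <= 1 / 2 -> is_derive Q v (PI * sin (M * PI * v) * cos (PI * v) / (M * sin (PI * v) ^ 2))).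
  { intros v Hv. specialize (Hmono v Hv).
    replace (PI * sin (M * PI * v) * cos (PI * v) / (M * sin (PI * v) ^ 2)) with
      ((PI * cos (PI * v) / sin (PI * v) + - (2 * PI) * sin_sum 0 N v) -
       (PI * cos (M * PI * v) / sin (PI * v) - PI * sin (M * PI * v) * cos (PI * v) / (M * sin (PI * v) ^ 2))).
    - apply (is_derive_minus (K := R_AbsRing) (V := R_NormedModule)).
      apply (is_derive_plus (K := R_AbsRing) (V := R_NormedModule) (fun v => ln (2 * sin (PI * v)))).
      + auto_derive. lra. field. lra.
      + apply is_derive_cos_sum.
      + auto_derive. nra. field. lra.
    - replace (- (2 * PI) * sin_sum 0 N v) with (- PI * (2 * sin (PI * v) * sin_sum 0 N v) / sin (PI * v)) by (field; lra).
      rewrite dirichlet_kernel. fold M. field. lra. }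
  assert (HQb : forall v, a <= v <= 1 / 2 ->
     Rabs (PI * sin (M * PI * v) * cos (PI * v) / (M * sin (PI * v) ^ 2)) <= PI / s ^ 2 / M).
  { intros v Hv. specialize (Hmono v Hv).
    unfold Rdiv at 1. rewrite !Rabs_mult, (Rabs_pos_eq PI) by lra.
    rewrite (Rabs_pos_eq (/ _)) by (apply Rlt_le, Rinv_0_lt_compat; apply Rmult_lt_0_compat; [lra|apply pow_lt; lra]).
    replace (PI / s ^ 2 / M) with (PI * 1 * 1 * / (M * s ^ 2)) by (field; lra).
    assert (0 < M * s ^ 2) by (apply Rmult_lt_0_compat; [lra|apply pow_lt; lra]).
    apply Rmult_le_compat.
    - apply Rmult_le_pos; [apply Rmult_le_pos; [lra|apply Rabs_pos]|apply Rabs_pos].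
    - apply Rlt_le, Rinv_0_lt_compat. apply Rmult_lt_0_compat; [lra|apply pow_lt; lra].
    - apply Rmult_le_compat; [apply Rmult_le_pos; [lra|apply Rabs_pos]|apply Rabs_pos| |apply Rabs_cos_le].
      apply Rmult_le_compat_l; [lra|apply Rabs_sin_le].
    - apply Rinv_le_contravar; [assumption|]. apply Rmult_le_compat_l; [lra|]. apply pow_incr; lra. }
  assert (HQd : Rabs (Q (1 / 2) - Q x) <= PI / s ^ 2 / M * (1 / 2 - x)).
  { eapply derive_bound_le; [lra| |]; intros v Hv; [apply HQ|apply HQb]; lra. }
  assert (Hhalf : sin (PI * (1 / 2)) = 1) by (replace (PI * (1 / 2)) with (PI / 2) by field; apply sin_PI2).
  (* At 1/2 the logarithm is ln 2 and the cosine sum is minus the alternating harmonic sum, so only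
     a remainder of order 1/N is left. *)
  assert (HQh : Rabs (Q (1 / 2)) <= / INR (S (S N)) + 1 / M).
  { unfold Q. rewrite Hhalf, cos_sum_half, !Rmult_1_r. unfold Rminus at 1.
    eapply Rle_trans; [apply Rabs_triang|]. apply Rplus_le_compat. apply ln_2_alternating.
    rewrite Rabs_Ropp. unfold Rdiv. rewrite Rabs_mult, (Rabs_pos_eq (/ M)) by (apply Rlt_le, Rinv_0_lt_compat; lra).
    apply Rmult_le_compat_r; [apply Rlt_le, Rinv_0_lt_compat; lra|apply Rabs_sin_le]. }
  assert (Hosc : Rabs (sin (M * PI * x) / (M * sin (PI * x))) <= 1 / s / M).
  { specialize (Hmono x Hx). unfold Rdiv at 1. rewrite Rabs_mult.
    rewrite (Rabs_pos_eq (/ _)) by (apply Rlt_le, Rinv_0_lt_compat, Rmult_lt_0_compat; lra).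
    replace (1 / s / M) with (1 * / (M * s)) by (field; lra).
    apply Rmult_le_compat; [apply Rabs_pos| |apply Rabs_sin_le|].
    apply Rlt_le, Rinv_0_lt_compat, Rmult_lt_0_compat; lra.
    apply Rinv_le_contravar; [apply Rmult_lt_0_compat; lra|]. apply Rmult_le_compat_l; lra. }
  replace (ln (2 * sin (PI * x)) + cos_sum 1 N x) with
    (Q (1 / 2) - (Q (1 / 2) - Q x) + sin (M * PI * x) / (M * sin (PI * x))) by (unfold Q; ring).
  assert (Hps : 0 < PI / s ^ 2) by (apply Rdiv_lt_0_compat; [lra|apply pow_lt; lra]).
  assert (HiM : / M <= / INR (S N)) by (apply Rinv_le_contravar; lra).
  assert (0 < / M) by (apply Rinv_0_lt_compat; lra).
  assert (H1s : 0 < 1 / s) by (apply Rdiv_lt_0_compat; lra).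
  apply Rle_trans with (/ INR (S (S N)) + 1 / M + PI / s ^ 2 / M * (1 / 2 - x) + 1 / s / M).
  - eapply Rle_trans; [apply Rabs_triang|]. apply Rplus_le_compat; [|assumption].
    unfold Rminus at 1. eapply Rle_trans; [apply Rabs_triang|]. rewrite Rabs_Ropp. now apply Rplus_le_compat.
  - assert (PI / s ^ 2 / M * (1 / 2 - x) <= PI / s ^ 2 * / M).
    { unfold Rdiv at 1. rewrite <- (Rmult_1_r (PI / s ^ 2 * / M)) at 2. apply Rmult_le_compat_l; [nra|lra]. }
    apply Rle_trans with (/ INR (S (S N)) + (1 / s + 1 + PI / s ^ 2) * / M).
    + unfold Rdiv at 1 4. lra.
    + apply Rplus_le_compat_l. apply Rmult_le_compat_l; lra.
Qed.


(** * The cosine series with cubes as a second primitive *)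

Definition clausen_cos (x : R) : R :=
  Series (fun n => cos (2 * PI * INR (S n) * x) / INR (S n) ^ 3).

Lemma inv_INR_0 : is_lim_seq (fun n => / INR (S n)) 0.
Proof.
  replace (Finite 0) with (Rbar_inv p_infty) by reflexivity.
  apply is_lim_seq_inv; [|discriminate]. apply (is_lim_seq_incr_1 INR), is_lim_seq_INR.
Qed.

Lemma clausen_cos_correct (x : R) : ex_series (fun n => / INR (S n) ^ 3) ->
  is_series (fun n => cos (2 * PI * INR (S n) * x) / INR (S n) ^ 3) (clausen_cos x).
Proof.
  intros H. apply Series_correct.
  apply (ex_series_le (K := R_AbsRing) (V := R_CompleteNormedModule) _ (fun n => / INR (S n) ^ 3)); [|assumption].
  intros n. change (Rabs (cos (2 * PI * INR (S n) * x) / INR (S n) ^ 3) <= / INR (S n) ^ 3).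
  pose proof (pow_lt _ 3 (lt_0_INR (S n) ltac:(lia))) as Hp. apply Rinv_0_lt_compat in Hp.
  unfold Rdiv. rewrite Rabs_mult, (Rabs_pos_eq (/ _)) by lra.
  pose proof (Rabs_cos_le (2 * PI * INR (S n) * x)). nra.
Qed.

(** The Fourier bound is uniform on [x, 1/2], so it can be integrated twice from 1/2, where the sine
    sums vanish; the slope there is subtracted before the second integration. As N grows, the
    difference of the two functions is seen to be affine. *)
Lemma clausen_primitive_affine (z : nat -> R) (x : R) :
  even_zeta_values z -> ex_series (fun n => / INR (S n) ^ 3) -> 0 < x <= 1 / 2 ->
  clausen_primitive z x - clausen_cos x / (4 * PI ^ 2) - clausen_primitive_derivative z (1 / 2) * x =
  clausen_primitive z (1 / 2) - clausen_cos (1 / 2) / (4 * PI ^ 2) - clausen_primitive_derivative z (1 / 2) * (1 / 2).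
Proof.
  intros Hz H3 Hx. pose proof PI_RGT_0 as HPI.
  set (kap := clausen_primitive_derivative z (1 / 2)).
  set (D1 := fun N v => clausen_primitive_derivative z v + sin_sum 2 N v / (2 * PI)).
  set (D0 := fun N v => clausen_primitive z v - cos_sum 3 N v / (4 * PI ^ 2) - kap * v).
  set (eps := fun N => / INR (S (S N)) + (1 / sin (PI * x) + 1 + PI / sin (PI * x) ^ 2) * / INR (S N)).
  assert (Heps : is_lim_seq eps 0).
  { replace (Finite 0) with (Finite (0 + (1 / sin (PI * x) + 1 + PI / sin (PI * x) ^ 2) * 0)) by (f_equal; ring).
    apply is_lim_seq_plus'. apply (is_lim_seq_incr_1 (fun n => / INR (S n))), inv_INR_0.
    apply (is_lim_seq_scal_l _ (1 / sin (PI * x) + 1 + PI / sin (PI * x) ^ 2) 0), inv_INR_0. }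
  assert (HD1 : forall N v, x <= v <= 1 / 2 -> Rabs (D1 N v - kap) <= eps N).
  { intros N v Hv.
    assert (E : D1 N (1 / 2) = kap) by (unfold D1; rewrite sin_sum_half; unfold kap; field; lra).
    rewrite <- E, <- Rabs_Ropp, Ropp_minus_distr.
    assert (Hp : 0 <= eps N).
    { eapply Rle_trans; [apply Rabs_pos|]. apply (log_sine_fourier_bound x x N); lra. }
    apply Rle_trans with (eps N * (1 / 2 - v)).
    - apply derive_bound_le with (fun v => ln (2 * sin (PI * v)) + cos_sum 1 N v); [lra| |].
      + intros w Hw. apply (is_derive_plus (K := R_AbsRing) (V := R_NormedModule)).
        apply is_derive_clausen_primitive_derivative; [assumption|lra].
        apply is_derive_ext with (fun v => / (2 * PI) * sin_sum 2 N v).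
        intros t. unfold Rdiv. eq_R. ring.
        replace (cos_sum 1 N w) with (/ (2 * PI) * (2 * PI * cos_sum 1 N w)) by (field; lra).
        apply is_derive_scal, is_derive_sin_sum.
      + intros w Hw. apply log_sine_fourier_bound; lra.
    - nra. }
  assert (HD0 : forall N, Rabs (D0 N (1 / 2) - D0 N x) <= eps N).
  { intros N. assert (Hp : 0 <= eps N).
    { eapply Rle_trans; [apply Rabs_pos|]. apply (HD1 N x); lra. }
    apply Rle_trans with (eps N * (1 / 2 - x)).
    - apply derive_bound_le with (fun v => D1 N v - kap); [lra| |].
      + intros w Hw. unfold D0, D1.
        apply (is_derive_minus (K := R_AbsRing) (V := R_NormedModule)
           (fun v => clausen_primitive z v - cos_sum 3 N v / (4 * PI ^ 2))).
        * replace (clausen_primitive_derivative z w + sin_sum 2 N w / (2 * PI)) with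
            (clausen_primitive_derivative z w - / (4 * PI ^ 2) * (- (2 * PI) * sin_sum 2 N w)) by (field; lra).
          apply (is_derive_minus (K := R_AbsRing) (V := R_NormedModule)).
          apply is_derive_clausen_primitive; [assumption|lra].
          apply is_derive_ext with (fun v => / (4 * PI ^ 2) * cos_sum 3 N v).
          intros t. unfold Rdiv. eq_R. ring.
          apply is_derive_scal, is_derive_cos_sum.
        * auto_derive. exact I. ring.
      + intros w Hw. apply HD1; lra.
    - nra. }
  assert (Hlim : forall v, is_lim_seq (fun N => D0 N v)
     (clausen_primitive z v - clausen_cos v / (4 * PI ^ 2) - kap * v)).
  { intros v. unfold D0. apply is_lim_seq_minus'; [|apply is_lim_seq_const].
    apply is_lim_seq_minus'; [apply is_lim_seq_const|].
    unfold Rdiv. apply (is_lim_seq_scal_r _ (/ (4 * PI ^ 2)) (clausen_cos v)).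
    exact (clausen_cos_correct v H3). }
  pose proof (is_lim_seq_minus' _ _ _ _ (Hlim (1 / 2)) (Hlim x)) as H1.
  assert (H2 : is_lim_seq (fun N => D0 N (1 / 2) - D0 N x) 0).
  { apply is_lim_seq_abs_0. apply is_lim_seq_le_le with (fun _ => 0) eps.
    - intros N. split. apply Rabs_pos. apply HD0.
    - apply is_lim_seq_const.
    - exact Heps. }
  apply is_lim_seq_unique in H1. apply is_lim_seq_unique in H2. rewrite H1 in H2.
  apply (f_equal real) in H2. cbn [real] in H2. lra.
Qed.

(** Interpolates between the bounds a^2 / 2 and 2. The exponent 3/2 lies strictly between 1 and 2:
    above 1 it yields o(x) at the origin, below 2 it keeps the sum of n^(3/2 - 3) finite. *)
Lemma one_minus_cos_le_pow_3_2 (a : R) : 0 <= a -> 0 <= 1 - cos a <= a * sqrt a.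
Proof.
  intros Ha. pose proof (one_minus_cos_bounds a) as H1. pose proof (COS_bound a) as H2.
  pose proof (sqrt_pos a) as Hr. pose proof (sqrt_sqrt a Ha) as Hs.
  set (r := sqrt a) in *. split; [lra|].
  destruct (Rle_dec r 2).
  - assert (a <= 2 * r) by nra. assert (a * a <= a * (2 * r)) by (apply Rmult_le_compat_l; lra). lra.
  - assert (4 <= a) by nra. assert (4 * 2 <= a * r) by (apply Rmult_le_compat; lra). lra.
Qed.

(** Termwise, (2 pi x n)^(3/2) / n^3 = (2 pi x)^(3/2) sqrt n / n^2, and [W] sums the factor free of
    x. *)
Lemma clausen_cos_near_0 (x z3 W : R) : 0 <= x ->
  is_series (fun n => / INR (S n) ^ 3) z3 ->
  is_series (fun n => sqrt (INR (S n)) / INR (S n) ^ 2) W ->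
  Rabs (clausen_cos x - z3) <= 2 * PI * x * sqrt (2 * PI * x) * W.
Proof.
  intros Hx H3 HW. pose proof PI_RGT_0 as HPI.
  assert (Hpx : 0 <= 2 * PI * x) by (apply Rmult_le_pos; lra).
  pose proof (clausen_cos_correct x (ex_intro _ _ H3)) as HC.
  pose proof (is_series_minus_R _ _ _ _ H3 HC) as HD.
  pose proof (is_series_mul_R (2 * PI * x * sqrt (2 * PI * x)) _ _ HW) as HU.
  assert (Hb : forall n, 0 <= / INR (S n) ^ 3 - cos (2 * PI * INR (S n) * x) / INR (S n) ^ 3 <=
     2 * PI * x * sqrt (2 * PI * x) * (sqrt (INR (S n)) / INR (S n) ^ 2)).
  { intros n. pose proof (lt_0_INR (S n) ltac:(lia)) as Hn. set (k := INR (S n)) in *.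
    replace (2 * PI * k * x) with (2 * PI * x * k) by ring.
    pose proof (one_minus_cos_le_pow_3_2 (2 * PI * x * k) ltac:(apply Rmult_le_pos; lra)) as H.
    rewrite sqrt_mult in H by lra.
    assert (H3p : 0 < / k ^ 3) by (apply Rinv_0_lt_compat, pow_lt; assumption).
    replace (/ k ^ 3 - cos (2 * PI * x * k) / k ^ 3) with ((1 - cos (2 * PI * x * k)) * / k ^ 3) by (field; lra).
    replace (2 * PI * x * sqrt (2 * PI * x) * (sqrt k / k ^ 2)) with
      (2 * PI * x * k * (sqrt (2 * PI * x) * sqrt k) * / k ^ 3) by (field; lra).
    split. apply Rmult_le_pos; lra. apply Rmult_le_compat_r; lra. }
  assert (H0 : 0 <= z3 - clausen_cos x).
  { apply (is_lim_seq_le (fun _ => 0) _ 0 (z3 - clausen_cos x)) with (3 := HD); [|apply is_lim_seq_const].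
    intros N. rewrite sum_n_Reals. apply cond_pos_sum. intros n; apply Hb. }
  rewrite <- Rabs_Ropp, Ropp_minus_distr, Rabs_pos_eq by assumption.
  rewrite <- (is_series_unique _ _ HD), <- (is_series_unique _ _ HU).
  apply Series_le. exact Hb. eexists; exact HU.
Qed.

(** After division by x the delicate term is x ln x, which along x = 1/(n+2) is -ln (n+2) / (n+2).
    The double primitive has no terms below x^2, so its quotient by x vanishes at 0. A sequence is
    enough to determine an affine function. *)
Lemma clausen_primitive_little_o (z : nat -> R) : even_zeta_values z ->
  is_lim_seq (fun n => clausen_primitive z (/ INR (S (S n))) / (/ INR (S (S n)))) 0.
Proof.
  intros Hz. pose proof PI_RGT_0 as HPI.
  set (x := fun n => / INR (S (S n))).
  assert (Hx : is_lim_seq x 0) by apply (is_lim_seq_incr_1 (fun n => / INR (S n))), inv_INR_0.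
  set (gam := PS_Int (PS_Int (log_sine_coef z))).
  assert (Hr : forall u, Rabs u < 1 -> Rbar_lt (Rabs u) (CV_radius gam)).
  { intros u Hu. unfold gam. rewrite !CV_radius_Int. now apply log_sine_radius. }
  assert (Hxp : forall n, 0 < x n < 1).
  { intros n. unfold x. split. apply Rinv_0_lt_compat, lt_0_INR; lia.
    rewrite <- Rinv_1. apply Rinv_lt_contravar; rewrite !S_INR; pose proof (pos_INR n); nra. }
  apply is_lim_seq_ext with (fun n => 1 / 2 * ln (2 * PI) * x n - 1 / 2 * (ln (INR (S (S n))) / INR (S (S n)))
     - 3 / 4 * x n - PSeries (PS_decr_1 gam) (x n)).
  { intros n. fold (x n). specialize (Hxp n). unfold clausen_primitive. fold gam.
    rewrite (PSeries_decr_1 gam) by (apply CV_radius_inside, Hr; rewrite Rabs_pos_eq; lra).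
    change (gam 0%nat) with 0. rewrite (ln_mult (2 * PI) (x n)) by lra.
    assert (E : ln (INR (S (S n))) = - ln (x n)) by (unfold x; rewrite ln_Rinv by (apply lt_0_INR; lia); ring).
    assert (E' : ln (INR (S (S n))) / INR (S (S n)) = - ln (x n) * x n) by (rewrite E; reflexivity).
    rewrite E'. field. lra. }
  replace (Finite 0) with (Finite (1 / 2 * ln (2 * PI) * 0 - 1 / 2 * 0 - 3 / 4 * 0 - gam 1%nat))
    by (f_equal; unfold gam, PS_Int; simpl; field).
  apply is_lim_seq_minus'; [apply is_lim_seq_minus'; [apply is_lim_seq_minus'|]|].
  - apply (is_lim_seq_scal_l _ (1 / 2 * ln (2 * PI)) 0 Hx).
  - apply (is_lim_seq_scal_l _ (1 / 2) 0).
    apply (is_lim_comp_seq (fun y => ln y / y) (fun n => INR (S (S n))) p_infty 0).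
    + apply is_lim_div_ln_p.
    + exists 0%nat. intros; discriminate.
    + apply (is_lim_seq_incr_1 (fun n => INR (S n))), (is_lim_seq_incr_1 INR), is_lim_seq_INR.
  - apply (is_lim_seq_scal_l _ (3 / 4) 0 Hx).
  - change (gam 1%nat) with (PS_decr_1 gam 0%nat). rewrite <- PSeries_0.
    apply is_lim_seq_continuous; [|exact Hx].
    apply PSeries_continuity. rewrite CV_radius_decr_1. apply Hr. rewrite Rabs_R0; lra.
Qed.

(** The two sides differ by an affine function b + kap x, which is o(x) along x = 1/(n+2); this
    forces b = 0 and then kap = 0. *)
Lemma clausen_primitive_eq (z : nat -> R) (z3 W x : R) :
  even_zeta_values z -> is_series (fun n => / INR (S n) ^ 3) z3 ->
  is_series (fun n => sqrt (INR (S n)) / INR (S n) ^ 2) W -> 0 < x <= 1 / 2 ->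
  clausen_primitive z x = (clausen_cos x - z3) / (4 * PI ^ 2).
Proof.
  intros Hz H3 HW Hx. pose proof PI_RGT_0 as HPI.
  set (kap := clausen_primitive_derivative z (1 / 2)).
  set (b := clausen_primitive z (1 / 2) - clausen_cos (1 / 2) / (4 * PI ^ 2) - kap * (1 / 2) + z3 / (4 * PI ^ 2)).
  assert (Haff : forall v, 0 < v <= 1 / 2 ->
     clausen_primitive z v - (clausen_cos v - z3) / (4 * PI ^ 2) = b + kap * v).
  { intros v Hv. pose proof (clausen_primitive_affine z v Hz (ex_intro _ _ H3) Hv) as H.
    fold kap in H. unfold b. rewrite <- H. field. lra. }
  set (v := fun n => / INR (S (S n))).
  assert (Hvp : forall n, 0 < v n <= 1 / 2).
  { intros n. unfold v. split. apply Rinv_0_lt_compat, lt_0_INR; lia.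
    unfold Rdiv. rewrite Rmult_1_l. apply Rinv_le_contravar; rewrite ?S_INR; pose proof (pos_INR n); lra. }
  assert (Hv0 : is_lim_seq v 0) by apply (is_lim_seq_incr_1 (fun n => / INR (S n))), inv_INR_0.
  set (rho := fun n => clausen_primitive z (v n) / v n - (clausen_cos (v n) - z3) / v n / (4 * PI ^ 2)).
  assert (Hrho : is_lim_seq rho 0).
  { replace (Finite 0) with (Finite (0 - 0 * / (4 * PI ^ 2))) by (f_equal; ring).
    apply is_lim_seq_minus'. apply (clausen_primitive_little_o z Hz).
    apply (is_lim_seq_scal_r _ (/ (4 * PI ^ 2)) 0).
    apply is_lim_seq_abs_0.
    apply is_lim_seq_le_le with (fun _ => 0) (fun n => 2 * PI * W * sqrt (2 * PI * v n)).
    - intros n. specialize (Hvp n). split. apply Rabs_pos.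
      unfold Rdiv. rewrite Rabs_mult, (Rabs_pos_eq (/ v n)) by (apply Rlt_le, Rinv_0_lt_compat; lra).
      apply (Rmult_le_reg_r (v n)); [lra|]. rewrite Rmult_assoc, Rinv_l, Rmult_1_r by lra.
      pose proof (clausen_cos_near_0 (v n) z3 W ltac:(lra) H3 HW). lra.
    - apply is_lim_seq_const.
    - replace (Finite 0) with (Finite (2 * PI * W * sqrt (2 * PI * 0))) by (rewrite Rmult_0_r, sqrt_0; f_equal; ring).
      apply (is_lim_seq_continuous (fun y => 2 * PI * W * sqrt (2 * PI * y)) v 0); [|exact Hv0].
      apply continuity_pt_filterlim.
      apply (continuous_mult (K := R_AbsRing) (fun _ => 2 * PI * W) (fun y => sqrt (2 * PI * y))). apply continuous_const.
      apply (continuous_comp (fun y => 2 * PI * y) sqrt). apply continuous_of_ex_derive; auto_derive; exact I.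
      apply continuous_sqrt. }
  assert (Erho : forall n, v n * rho n = b + kap * v n).
  { intros n. specialize (Hvp n). rewrite <- Haff by assumption. unfold rho. field. lra. }
  assert (Hb : b = 0).
  { assert (H1 : is_lim_seq (fun n => v n * rho n - kap * v n) (0 * 0 - kap * 0)).
    { apply is_lim_seq_minus'. now apply is_lim_seq_mult'. apply (is_lim_seq_scal_l _ kap 0 Hv0). }
    apply is_lim_seq_unique in H1.
    rewrite (Lim_seq_ext _ (fun _ => b)), Lim_seq_const in H1 by (intros n; rewrite Erho; ring).
    injection H1. lra. }
  assert (Hk : kap = 0).
  { apply is_lim_seq_unique in Hrho.
    rewrite (Lim_seq_ext _ (fun _ => kap)), Lim_seq_const in Hrho. now injection Hrho.
    intros n. specialize (Erho n). specialize (Hvp n). rewrite Hb in Erho.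
    apply (Rmult_eq_reg_l (v n)); lra. }
  specialize (Haff x Hx). rewrite Hb, Hk in Haff. lra.
Qed.

(** * Evaluation at 1/3, 1/4, 1/6 *)


Lemma is_series_zero : is_series (fun _ => 0) 0.
Proof.
  apply is_lim_seq_of_is_series. apply is_lim_seq_ext with (fun _ => 0); [|apply is_lim_seq_const].
  intros n. rewrite sum_n_const. ring.
Qed.

Lemma is_series_head (c : R) : is_series (fun n => match n with O => c | S _ => 0 end) c.
Proof.
  apply (is_series_decr_1 (K := R_AbsRing) (V := R_NormedModule)).
  eapply is_series_ext_R; [| |exact is_series_zero]; [reflexivity|].
  unfold plus, opp; simpl. ring.
Qed.

(** Two integrations divide the coefficient of x^(2n) by (2n+1)(2n+2) and raise the exponent by 2,
    which the quotient by x^2 undoes. The coefficients are nonnegative, so convergence follows by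
    comparison with the series before integration. *)
Lemma log_sine_double_primitive_series (z : nat -> R) (x : R) : even_zeta_values z -> 0 < x < 1 ->
  is_series (fun n => log_sine_coef z (2 * n) * x ^ (2 * n) / (INR (2 * n + 1) * INR (2 * n + 2)))
    (PSeries (PS_Int (PS_Int (log_sine_coef z))) x / x ^ 2).
Proof.
  intros Hz Hx. set (be := log_sine_coef z). set (gam := PS_Int (PS_Int be)).
  assert (Hodd : forall n, gam (2 * n + 1)%nat = 0).
  { intros [|n]. unfold gam, PS_Int; simpl. field.
    replace (2 * S n + 1)%nat with (S (S (2 * n + 1))) by lia.
    unfold gam, PS_Int. unfold be. rewrite log_sine_coef_odd. unfold Rdiv. ring. }
  assert (Hev : forall n, gam (2 * S n)%nat * x ^ (2 * S n) =
     x ^ 2 * (be (2 * n)%nat * x ^ (2 * n) / (INR (2 * n + 1) * INR (2 * n + 2)))).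
  { intros n. replace (2 * S n)%nat with (S (S (2 * n))) by lia. unfold gam, PS_Int.
    replace (2 * n + 2)%nat with (S (S (2 * n))) by lia.
    replace (2 * n + 1)%nat with (S (2 * n)) by lia. cbn [pow].
    field. split; apply not_0_INR; lia. }
  assert (Hbe0 : forall n, 0 <= be (2 * n)%nat * x ^ (2 * n)).
  { intros n. apply Rmult_le_pos; [|apply pow_le; lra]. unfold be. rewrite log_sine_coef_even.
    destruct n as [|n]; [lra|]. apply Rdiv_le_0_compat; [|apply lt_0_INR; lia].
    apply (is_lim_seq_le (fun _ => 0) _ 0 (z (S n))) with (3 := Hz n); [|apply is_lim_seq_const].
    intros N. rewrite sum_n_Reals. apply cond_pos_sum. intros m.
    apply Rlt_le, Rinv_0_lt_compat, pow_lt, lt_0_INR. lia. }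
  assert (Hex : ex_series (fun n => be (2 * n)%nat * x ^ (2 * n) / (INR (2 * n + 1) * INR (2 * n + 2)))).
  { apply (ex_series_le (K := R_AbsRing) (V := R_CompleteNormedModule) _ (fun n => be (2 * n)%nat * x ^ (2 * n))).
    - intros n. change (Rabs (be (2 * n)%nat * x ^ (2 * n) / (INR (2 * n + 1) * INR (2 * n + 2))) <=
        be (2 * n)%nat * x ^ (2 * n)).
      assert (H1 : 1 <= INR (2 * n + 1) * INR (2 * n + 2)).
      { rewrite <- mult_INR. change 1 with (INR 1). apply le_INR. nia. }
      specialize (Hbe0 n). rewrite Rabs_pos_eq by (apply Rdiv_le_0_compat; lra).
      apply Rle_div_l; [lra|]. nra.
    - eexists. now apply log_sine_even_series. }
  pose proof (Series_correct _ Hex) as HT. set (T := Series _) in HT.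
  assert (HE : is_pseries (fun n => gam (2 * n)%nat) (x ^ 2) (x ^ 2 * T)).
  { apply is_pseries_R. apply (is_series_decr_1 (K := R_AbsRing) (V := R_NormedModule)).
    eapply is_series_ext_R; [| |exact (is_series_mul_R (x ^ 2) _ _ HT)].
    - intros n. cbv beta. rewrite <- pow_mult, Hev. reflexivity.
    - change (gam (2 * 0)%nat) with 0. unfold plus, opp; simpl. ring. }
  assert (HO : is_pseries (fun n => gam (2 * n + 1)%nat) (x ^ 2) 0).
  { apply is_pseries_R. eapply is_series_ext_R; [|reflexivity|exact is_series_zero].
    intros n. cbv beta. rewrite Hodd. ring. }
  rewrite (is_pseries_unique _ _ _ (is_pseries_odd_even gam x _ _ HE HO)).
  replace ((x ^ 2 * T + x * 0) / x ^ 2) with T by (field; lra). exact HT.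
Qed.

Lemma even_zeta_series_clausen (z : nat -> R) (z3 W x : R) :
  even_zeta_values z -> z 0%nat = - (1 / 2) -> is_series (fun n => / INR (S n) ^ 3) z3 ->
  is_series (fun n => sqrt (INR (S n)) / INR (S n) ^ 2) W -> 0 < x <= 1 / 2 ->
  is_series (fun k => INR (2 * k + 3) / (INR (2 * k + 1) * INR (2 * k + 2)) * (z k * x ^ (2 * k)))
    (- ln (2 * sin (PI * x)) / 2 + (clausen_cos x - z3) / (4 * PI ^ 2 * x ^ 2)).
Proof.
  intros Hz Hz0 H3 HW Hx. pose proof PI_RGT_0 as HPI.
  assert (Hx1 : 0 < x < 1) by lra.
  pose proof (is_series_mul_R (1 / 2) _ _ (log_sine_even_series z x Hz Hx1)) as S1.
  pose proof (log_sine_double_primitive_series z x Hz Hx1) as S2.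
  (* The logarithm series has zero term at k = 0; the value -3/4 = c_0 zeta(0), with c_0 = 3/2, is
     inserted there and cancels against the 3/4 x^2 of [clausen_primitive] after division by x^2. *)
  pose proof (is_series_plus_R _ _ _ _ (is_series_minus_R _ _ _ _ S1 S2) (is_series_head (- (3 / 4)))) as S3.
  eapply is_series_ext_R; [| |exact S3].
  - intros [|k]; cbv beta; rewrite log_sine_coef_even.
    + rewrite Hz0. simpl. field.
    + rewrite !plus_INR, mult_INR. pose proof (lt_0_INR (S k) ltac:(lia)) as Hk.
      set (n := INR (S k)) in *. simpl INR. field. lra.
  - pose proof (clausen_primitive_eq z z3 W x Hz H3 HW Hx) as HK. unfold clausen_primitive in HK.
    set (P := PSeries _ x) in *.
    assert (Hpx : 0 < PI * x) by (apply Rmult_lt_0_compat; lra).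
    assert (Hs : 0 < sin (PI * x)) by (apply sin_gt_0; nra).
    assert (EP : P = x ^ 2 / 2 * ln (2 * PI * x) - 3 / 4 * x ^ 2 - (clausen_cos x - z3) / (4 * PI ^ 2)) by lra.
    rewrite EP. replace (2 * PI * x) with (2 * (PI * x)) by ring.
    rewrite ln_div, !ln_mult by lra. field. lra.
Qed.

(** * Cosines at multiples of 2 pi / q through divisibility indicators *)

Definition multiple_indicator (q n : nat) : R := if Nat.eqb (n mod q) 0 then 1 else 0.

Lemma multiple_indicator_add (q k n : nat) : q <> 0%nat ->
  multiple_indicator q (n + k * q) = multiple_indicator q n.
Proof. intros Hq. unfold multiple_indicator. now rewrite Nat.Div0.mod_add. Qed.

(** The multiples of q up to N + 1 are q m with 1 <= m <= (N + 1) / q, so the partial sum is q^(-3)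
    times a partial sum of the full series. [T m] counts m terms, and [T 0 = 0] covers N + 1 < q. *)
Lemma multiples_inverse_cubes (q : nat) (z3 : R) : q <> 0%nat ->
  is_series (fun n => / INR (S n) ^ 3) z3 ->
  is_series (fun n => multiple_indicator q (S n) / INR (S n) ^ 3) (z3 / INR q ^ 3).
Proof.
  intros Hq H3.
  set (T := fun m => match m with O => 0 | S m => sum_n (fun n => / INR (S n) ^ 3) m end).
  assert (Hqp : 0 < INR q) by (apply lt_0_INR; lia).
  assert (HT : forall m, T (S m) = T m + / INR (S m) ^ 3).
  { intros [|m]. unfold T. rewrite sum_O. ring. unfold T. now rewrite sum_n_S. }
  assert (HS : forall N, sum_n (fun n => multiple_indicator q (S n) / INR (S n) ^ 3) N = / INR q ^ 3 * T (S N / q)%nat).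
  { assert (Hstep : forall N, multiple_indicator q (S N) / INR (S N) ^ 3 = / INR q ^ 3 * T (S N / q)%nat - / INR q ^ 3 * T (N / q)%nat).
    { intros N. pose proof (Nat.div_mod N q Hq) as E1. pose proof (Nat.mod_upper_bound N q Hq) as B1.
      pose proof (Nat.div_mod (S N) q Hq) as E2. pose proof (Nat.mod_upper_bound (S N) q Hq) as B2.
      unfold multiple_indicator. destruct (Nat.eqb_spec (S N mod q) 0) as [E|E].
      - assert (ED : (S N / q = S (N / q))%nat) by nia. rewrite ED, HT.
        assert (EN : INR (S N) = INR q * INR (S (N / q))) by (rewrite <- mult_INR; f_equal; nia).
        rewrite EN. pose proof (lt_0_INR (S (N / q)) ltac:(lia)). field. lra.
      - assert (ED : (S N / q = N / q)%nat) by nia. rewrite ED. unfold Rdiv. ring. }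
    induction N as [|N IH].
    - rewrite sum_O, Hstep, Nat.Div0.div_0_l. unfold T at 2. eq_R. ring.
    - rewrite sum_n_S, IH, Hstep. eq_R. ring. }
  apply is_lim_seq_of_is_series.
  apply is_lim_seq_ext with (fun N => / INR q ^ 3 * T (S N / q)%nat); [intros; now rewrite HS|].
  replace (Finite (z3 / INR q ^ 3)) with (Rbar_mult (/ INR q ^ 3) z3) by (simpl; f_equal; unfold Rdiv; ring).
  apply is_lim_seq_scal_l.
  assert (HTl : is_lim_seq T z3) by (apply is_lim_seq_incr_1; exact H3).
  apply (is_lim_seq_subseq T z3 (fun N => (S N / q)%nat)); [|exact HTl].
  intros P [M HM]. exists (M * q)%nat. intros n Hn. apply HM.
  apply Nat.div_le_lower_bound; lia.
Qed.

Lemma periodic_ind (q : nat) (P : nat -> Prop) : q <> 0%nat ->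
  (forall r, (r < q)%nat -> P r) -> (forall n, P n -> P (n + q)%nat) -> forall n, P n.
Proof.
  intros Hq Hr Hs n. induction n as [n IH] using (well_founded_induction Nat.lt_wf_0).
  destruct (Nat.lt_ge_cases n q) as [H|H]. now apply Hr.
  replace n with (n - q + q)%nat by lia. apply Hs, IH. lia.
Qed.

(** For q = 3, 4, 6 the value cos (2 pi n / q) is rational and depends only on gcd (n, q), hence is
    a combination of indicators of divisors of q. The alternatives on [a2], ..., [a6] make the right
    side q-periodic, so residues r < q suffice; 8, 27, 64, 216 are the cubes d^3. *)
Lemma clausen_cos_periodic (a a2 a3 a4 a6 x z3 : R) (q : nat) :
  q <> 0%nat -> INR q * x = 1 ->
  a2 = 0 \/ (q mod 2 = 0)%nat -> a3 = 0 \/ (q mod 3 = 0)%nat ->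
  a4 = 0 \/ (q mod 4 = 0)%nat -> a6 = 0 \/ (q mod 6 = 0)%nat ->
  (forall r, (r < q)%nat -> cos (2 * PI * INR r * x) =
     a + a2 * multiple_indicator 2 r + a3 * multiple_indicator 3 r
     + a4 * multiple_indicator 4 r + a6 * multiple_indicator 6 r) ->
  is_series (fun n => / INR (S n) ^ 3) z3 ->
  clausen_cos x = (a + a2 / 8 + a3 / 27 + a4 / 64 + a6 / 216) * z3.
Proof.
  intros Hq Hx H2 H3' H4 H6 Hr H3.
  assert (Hind : forall c d n, d <> 0%nat -> c = 0 \/ (q mod d = 0)%nat ->
     c * multiple_indicator d (n + q) = c * multiple_indicator d n).
  { intros c d n Hd [->|E]; [ring|]. f_equal.
    rewrite (Nat.div_mod q d Hd), E, Nat.add_0_r, Nat.mul_comm. now apply multiple_indicator_add. }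
  assert (Hall : forall n, cos (2 * PI * INR n * x) =
     a + a2 * multiple_indicator 2 n + a3 * multiple_indicator 3 n
     + a4 * multiple_indicator 4 n + a6 * multiple_indicator 6 n).
  { apply (periodic_ind q); [assumption|exact Hr|]. intros n IH.
    rewrite !Hind by (assumption || lia). rewrite <- IH, plus_INR.
    replace (2 * PI * (INR n + INR q) * x) with (2 * PI * INR n * x + 2 * INR 1 * PI * (INR q * x)) by (simpl; ring).
    rewrite Hx, Rmult_1_r. apply cos_period. }
  apply is_series_unique.
  pose proof (fun q Hq => is_series_mul_R (match q with 2 => a2 | 3 => a3 | 4 => a4 | _ => a6 end%nat) _ _
    (multiples_inverse_cubes q z3 Hq H3)) as HM.
  pose proof (is_series_mul_R a _ _ H3) as H1.
  pose proof (is_series_plus_R _ _ _ _ (is_series_plus_R _ _ _ _ (is_series_plus_R _ _ _ _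
    (is_series_plus_R _ _ _ _ H1 (HM 2%nat ltac:(lia))) (HM 3%nat ltac:(lia))) (HM 4%nat ltac:(lia))) (HM 6%nat ltac:(lia))) as HS.
  eapply is_series_ext_R; [| |exact HS].
  - intros n. cbv beta. rewrite Hall. unfold Rdiv. ring.
  - simpl. field.
Qed.

Lemma clausen_cos_third (z3 : R) : is_series (fun n => / INR (S n) ^ 3) z3 ->
  clausen_cos (1 / 3) = - (4 / 9) * z3.
Proof.
  intros H3.
  (* cos (2 pi n / 3) is -1/2 plus 3/2 if 3 divides n, whence -1/2 + 1/18 = -4/9. *)
  rewrite (clausen_cos_periodic (- (1 / 2)) 0 (3 / 2) 0 0 _ z3 3); try assumption; try (simpl; auto; field).
  intros [|[|[|r]]] Hr; [| | |lia]; unfold multiple_indicator; simpl.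
  - replace (2 * PI * 0 * (1 / 3)) with 0 by field. rewrite cos_0. field.
  - replace (2 * PI * 1 * (1 / 3)) with (2 * (PI / 3)) by field. rewrite cos_2PI3. field.
  - replace (2 * PI * (1 + 1) * (1 / 3)) with (PI / 3 + PI) by field. rewrite neg_cos, cos_PI3. field.
Qed.

Lemma clausen_cos_quarter (z3 : R) : is_series (fun n => / INR (S n) ^ 3) z3 ->
  clausen_cos (1 / 4) = - (3 / 32) * z3.
Proof.
  intros H3.
  rewrite (clausen_cos_periodic 0 (- 1) 0 2 0 _ z3 4); try assumption; try (simpl; auto; field).
  intros [|[|[|[|r]]]] Hr; [| | | |lia]; unfold multiple_indicator; simpl.
  - replace (2 * PI * 0 * (1 / 4)) with 0 by field. rewrite cos_0. field.
  - replace (2 * PI * 1 * (1 / 4)) with (PI / 2) by field. rewrite cos_PI2. field.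
  - replace (2 * PI * (1 + 1) * (1 / 4)) with PI by field. rewrite cos_PI. field.
  - replace (2 * PI * (1 + 1 + 1) * (1 / 4)) with (PI / 2 + PI) by field. rewrite neg_cos, cos_PI2. field.
Qed.

Lemma clausen_cos_sixth (z3 : R) : is_series (fun n => / INR (S n) ^ 3) z3 ->
  clausen_cos (1 / 6) = 1 / 3 * z3.
Proof.
  intros H3.
  (* The residues 1, 2, 3, 0 determine the coefficients 1/2, -1, -3/2, 3 in turn. *)
  rewrite (clausen_cos_periodic (1 / 2) (- 1) (- (3 / 2)) 0 3 _ z3 6); try assumption; try (simpl; auto; field).
  intros [|[|[|[|[|[|r]]]]]] Hr; [| | | | | |lia]; unfold multiple_indicator; simpl.
  - replace (2 * PI * 0 * (1 / 6)) with 0 by field. rewrite cos_0. field.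
  - replace (2 * PI * 1 * (1 / 6)) with (PI / 3) by field. rewrite cos_PI3. field.
  - replace (2 * PI * (1 + 1) * (1 / 6)) with (2 * (PI / 3)) by field. rewrite cos_2PI3. field.
  - replace (2 * PI * (1 + 1 + 1) * (1 / 6)) with PI by field. rewrite cos_PI. field.
  - replace (2 * PI * (1 + 1 + 1 + 1) * (1 / 6)) with (PI / 3 + PI) by field. rewrite neg_cos, cos_PI3. field.
  - replace (2 * PI * (1 + 1 + 1 + 1 + 1) * (1 / 6)) with (2 * (PI / 3) + PI) by field. rewrite neg_cos, cos_2PI3. field.
Qed.

(** * Back to the complex zeta function *)

Lemma zeta_nat_value (zeta : C -> C) (m : nat) : is_riemann_zeta zeta -> (2 <= m)%nat ->
  zeta (RtoC (INR m)) = RtoC (fst (zeta (RtoC (INR m)))) /\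
  is_series (fun n => / INR (S n) ^ m) (fst (zeta (RtoC (INR m)))).
Proof.
  intros Hz Hm. apply le_INR in Hm. simpl in Hm.
  destruct (zeta_series_parts zeta (INR m) 0 Hz ltac:(lra)) as [S1 S2].
  fold (RtoC (INR m)) in S1, S2. split.
  - assert (E : - snd (zeta (RtoC (INR m))) = 0).
    { rewrite <- (is_series_unique _ _ S2).
      transitivity (Series (fun _ => 0)); [|exact (is_series_unique _ _ is_series_zero)].
      apply Series_ext. intros n. rewrite Rmult_0_l, sin_0. ring. }
    unfold RtoC at 2. rewrite (surjective_pairing (zeta (RtoC (INR m)))) at 1. f_equal. lra.
  - eapply is_series_ext_R; [|reflexivity|exact S1]. intros n. cbv beta.
    rewrite Rmult_0_l, cos_0, Rmult_1_r.
    replace (- INR m * ln (INR (S n))) with (- (INR m * ln (INR (S n)))) by ring.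
    rewrite exp_Ropp. f_equal. apply (Rpower_pow m (INR (S n))), lt_0_INR. lia.
Qed.

(** This is the Dirichlet series at s = 3/2, so its convergence is read off [is_riemann_zeta]. *)
Lemma sqrt_inverse_squares (zeta : C -> C) : is_riemann_zeta zeta ->
  exists W, is_series (fun n => sqrt (INR (S n)) / INR (S n) ^ 2) W.
Proof.
  intros Hz. destruct (zeta_series_parts zeta (3 / 2) 0 Hz ltac:(lra)) as [S1 _].
  exists (fst (zeta (3 / 2, 0))). eapply is_series_ext_R; [|reflexivity|exact S1].
  intros n. cbv beta. pose proof (lt_0_INR (S n) ltac:(lia)) as Hn. set (k := INR (S n)) in *.
  rewrite Rmult_0_l, cos_0, Rmult_1_r.
  assert (E : sqrt k = exp (1 / 2 * ln k)).
  { apply sqrt_lem_1; [lra|apply Rlt_le, exp_pos|]. rewrite <- exp_plus.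
    replace (1 / 2 * ln k + 1 / 2 * ln k) with (ln k) by field. now apply exp_ln. }
  replace (- (3 / 2) * ln k) with (1 / 2 * ln k + (- ln k + - ln k)) by field.
  rewrite !exp_plus, exp_Ropp, exp_ln, E by assumption. field. lra.
Qed.

(** The bound q >= 2 places 1/q in (0, 1/2]. All zeta(2k) are real, so the complex series splits
    into the real one and a zero series. *)
Lemma is_zeta_even_sum_clausen (zeta : C -> C) (q : R) : is_riemann_zeta zeta -> 2 <= q ->
  is_zeta_even_sum zeta q
    (RtoC (- ln (2 * sin (PI * (1 / q))) / 2 + (clausen_cos (1 / q) - fst (zeta (RtoC 3))) / (4 * PI ^ 2 * (1 / q) ^ 2))).
Proof.
  intros Hz Hq. set (z := fun k => fst (zeta (RtoC (INR (2 * k))))).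
  assert (E3 : INR 3 = 3) by (simpl; ring).
  destruct (zeta_nat_value zeta 3 Hz ltac:(lia)) as [_ H3]. rewrite E3 in H3.
  destruct (sqrt_inverse_squares zeta Hz) as [W HW].
  assert (Hev : even_zeta_values z).
  { intros k. apply zeta_nat_value; [assumption|lia]. }
  assert (Hz0 : z 0%nat = - (1 / 2)).
  { unfold z. simpl INR. rewrite (zeta_at_0 zeta Hz). reflexivity. }
  assert (Hzk : forall k, zeta (RtoC (INR (2 * k))) = RtoC (z k)).
  { intros [|k]. rewrite Hz0. simpl INR. now apply zeta_at_0.
    apply zeta_nat_value; [assumption|lia]. }
  assert (Hx : 0 < 1 / q <= 1 / 2).
  { split. apply Rdiv_lt_0_compat; lra. unfold Rdiv. rewrite !Rmult_1_l. apply Rinv_le_contravar; lra. }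
  pose proof (even_zeta_series_clausen z _ W (1 / q) Hev Hz0 H3 HW Hx) as HS.
  assert (Hterm : forall k, zeta_even_term zeta q k =
     RtoC (INR (2 * k + 3) / (INR (2 * k + 1) * INR (2 * k + 2)) * (z k * (1 / q) ^ (2 * k)))).
  { intros k. assert (Hp : q ^ (2 * k) <> 0) by (apply pow_nonzero; lra).
    unfold zeta_even_term. rewrite Hzk, <- RtoC_div, <- RtoC_mult by assumption.
    f_equal. f_equal. unfold Rdiv at 1 2. now rewrite Rmult_1_l, pow_inv. }
  apply is_series_C_iff. split.
  - eapply is_series_ext_R; [|reflexivity|exact HS]. intros k. now rewrite Hterm.
  - eapply is_series_ext_R; [|reflexivity|exact is_series_zero]. intros k. now rewrite Hterm.
Qed.

Lemma ln_of_square (s v : R) : 0 < s -> s * s = v -> ln s = ln v / 2.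
Proof. intros Hs <-. rewrite ln_mult by assumption. field. Qed.

Theorem theorem4p3 :
  forall zeta : C -> C, is_riemann_zeta zeta ->
    (exists S : C, is_zeta_even_sum zeta 3 S /\
       zeta (RtoC 3) =
         Cminus (RtoC (- (PI ^ 2 / 13) * ln 3))
                (Cmult (RtoC (4 * PI ^ 2 / 13)) S)) /\
    (exists S : C, is_zeta_even_sum zeta 4 S /\
       zeta (RtoC 3) =
         Cminus (RtoC (- (2 * PI ^ 2 / 35) * ln 2))
                (Cmult (RtoC (8 * PI ^ 2 / 35)) S)) /\
    (exists S : C, is_zeta_even_sum zeta 6 S /\
       zeta (RtoC 3) = Cmult (RtoC (- (PI ^ 2 / 6))) S).
Proof.
  intros zeta Hz. pose proof PI_RGT_0 as HPI.
  assert (E3 : INR 3 = 3) by (simpl; ring).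
  destruct (zeta_nat_value zeta 3 Hz ltac:(lia)) as [Er H3]. rewrite E3 in Er, H3.
  pose proof (clausen_cos_third _ H3) as C3. pose proof (clausen_cos_quarter _ H3) as C4.
  pose proof (clausen_cos_sixth _ H3) as C6.
  assert (L3 : ln (2 * sin (PI * (1 / 3))) = ln 3 / 2).
  { replace (PI * (1 / 3)) with (PI / 3) by field. rewrite sin_PI3.
    pose proof (sqrt_lt_R0 3 ltac:(lra)). pose proof (sqrt_sqrt 3 ltac:(lra)).
    apply ln_of_square; lra. }
  assert (L4 : ln (2 * sin (PI * (1 / 4))) = ln 2 / 2).
  { replace (PI * (1 / 4)) with (PI / 4) by field. rewrite sin_PI4.
    pose proof (sqrt_lt_R0 2 ltac:(lra)) as Hp. pose proof (sqrt_sqrt 2 ltac:(lra)) as Hs.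
    replace (2 * (1 / sqrt 2)) with (sqrt 2); [now apply ln_of_square|].
    apply (Rmult_eq_reg_r (sqrt 2)); [|lra]. rewrite Hs. field. lra. }
  assert (L6 : ln (2 * sin (PI * (1 / 6))) = 0).
  { replace (PI * (1 / 6)) with (PI / 6) by field. rewrite sin_PI6.
    replace (2 * (1 / 2)) with 1 by field. apply ln_1. }
  pose proof (is_zeta_even_sum_clausen zeta 3 Hz ltac:(lra)) as S3.
  pose proof (is_zeta_even_sum_clausen zeta 4 Hz ltac:(lra)) as S4.
  pose proof (is_zeta_even_sum_clausen zeta 6 Hz ltac:(lra)) as S6.
  (* C(1/q) - zeta(3) is -13/9, -35/32, -2/3 times zeta(3); multiplied by q^2 / (4 pi^2) this gives
     the factors -13 / (4 pi^2), -35 / (8 pi^2), -6 / pi^2 of zeta(3), and solving for zeta(3)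
     yields the three formulas. *)
  rewrite L3, C3 in S3. rewrite L4, C4 in S4. rewrite L6, C6 in S6.
  repeat split; eexists; (split; [eassumption|]); rewrite Er at 1;
    rewrite <- RtoC_mult, <- ?RtoC_minus; f_equal; field; lra.
Qed.
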